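(* Two $n$-dimensional simplicial complexes are piecewise linearly homeomorphic if and only if they are stellar equivalent.
   Context: A (finite) simplicial complex $K$ is a finite collection of simplexes contained linearly in some $\mathbb{R}^N$ such that (1) every face of a member of $K$ is in $K$, and (2) the intersection of any two members of $K$ is a face of both; the empty simplex $\emptyset$ counts as a face of every simplex. $|K|=\bigcup_{A\in K}A$. Complexes may also be viewed abstractly (a finite vertex set with specified subsets as simplexes). For a simplex $A$, the symbol $A$ also denotes the complex of all faces of $A$, and $\partial A$ the complex of its proper faces. The join of complexes is $K\star L=\{A\star B: A\in K, B\in L\}$ (vertices of $A$ and $B$ being independent, and $\emptyset\star A=A$). The link is $\mathrm{lk}(A,K)=\{B\in K: A\star B\in K\}$ and the star is $\mathrm{st}(A,K)=A\star \mathrm{lk}(A,K)$. A simplicial isomorphism is a bijection between vertices inducing a bijection between simplexes. A simplicial complex $K'$ is a subdivision of $K$ if $|K'|=|K|$ and each simplex of $K'$ is contained linearly in some simplex of $K$. Two simplicial complexes $K$ and $L$ are piecewise linearly homeomorphic if they have subdivisions $K'$, $L'$ that are simplicially isomorphic. Stellar subdivision: for a (non-empty) simplex $A\in K$ and a point $a$ in the interior of $A$ (abstractly: a new vertex $a\notin K$), $(A,a)K$ is the complex obtained from $K$ by removing $\mathrm{st}(A,K)$ and replacing it with $a\star\partial A\star\mathrm{lk}(A,K)$. The inverse operation $(A,a)^{-1}$ is called a stellar weld. Two complexes are stellar equivalent, written $K_1\sim K_2$, if they are related by a finite sequence of stellar subdivisions, stellar welds and simplicial isomorphisms. *)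

(* Defs.v *)
From mathcomp Require Import all_boot all_order all_algebra.
From mathcomp Require Import finmap.
From mathcomp Require Import boolp classical_sets functions reals.

Set Implicit Arguments.
Unset Strict Implicit.
Unset Printing Implicit Defensive.

Import Order.TTheory GRing.Theory Num.Theory.
Local Open Scope classical_set_scope.
Local Open Scope fset_scope.
Local Open Scope ring_scope.

(* A simplex is given by its finite set of vertices, so that a face is a
   subset; the empty simplex is fset0. *)
Section Simplexes.
Variables (R : realType) (N : nat).
Implicit Types A : {fset 'rV[R]_N}.

Definition affinely_independent A : Prop :=
  forall c : 'rV[R]_N -> R,
    \sum_(v <- A) c v = 0 -> \sum_(v <- A) c v *: v = 0 ->
    forall v, v \in A -> c v = 0.

(* For A = fset0 both sets below are empty, since an empty sum is not 1. *)
Definition hull A : set 'rV[R]_N :=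
  [set x | exists c : 'rV[R]_N -> R,
    [/\ forall v, v \in A -> 0 <= c v, \sum_(v <- A) c v = 1
      & x = \sum_(v <- A) c v *: v]].

Definition simplex_interior A : set 'rV[R]_N :=
  [set x | exists c : 'rV[R]_N -> R,
    [/\ forall v, v \in A -> 0 < c v, \sum_(v <- A) c v = 1
      & x = \sum_(v <- A) c v *: v]].

End Simplexes.

Record complex (R : realType) (N : nat) := Complex {
  simplexes :> {fset {fset 'rV[R]_N}};
  simplexes_independent : forall A, A \in simplexes -> affinely_independent A;
  simplexes_face : forall A B, A \in simplexes -> B `<=` A -> B \in simplexes;
  simplexes_meet : forall A B, A \in simplexes -> B \in simplexes ->
    exists C, [/\ C `<=` A, C `<=` B & (hull A `&` hull B)%classic = hull C]
}.

(* A simplex with k vertices has dimension k - 1. *)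
Definition has_dim (R : realType) (N : nat) (K : complex R N) (n : nat) : Prop :=
  (exists2 A, A \in simplexes K & #|` A| = n.+1) /\
  (forall A, A \in simplexes K -> (#|` A| <= n.+1)%N).

Section Combinatorics.
Variable V : choiceType.
Implicit Types (A : {fset V}) (K L : {fset {fset V}}).

Definition vertices K : set V := [set v | [fset v] \in K]%classic.

Definition faces A : {fset {fset V}} := fpowerset A.

Definition boundary A : {fset {fset V}} := faces A `\ A.

(* Meaningful when the vertices of K and L are independent; this is the case
   wherever join is used below. *)
Definition join K L : {fset {fset V}} := [fset A `|` B | A in K, B in L].

Definition link A K : {fset {fset V}} :=
  [fset B in K | fdisjoint A B && (A `|` B \in K)].

Definition star A K : {fset {fset V}} := join (faces A) (link A K).

(* (A, a)K *)
Definition stellar A (a : V) K : {fset {fset V}} :=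
  (K `\` star A K) `|` join (faces [fset a]) (join (boundary A) (link A K)).

End Combinatorics.

Definition simplicial_isomorphic (V W : choiceType)
    (K : {fset {fset V}}) (L : {fset {fset W}}) : Prop :=
  exists f : V -> W,
    set_bij (vertices K) (vertices L) f /\
    set_bij [set` K]%classic [set` L]%classic (fun A : {fset V} => f @` A).

Section Subdivision.
Variables (R : realType) (N : nat).
Implicit Types K : complex R N.

Definition polyhedron K : set 'rV[R]_N := \bigcup_(A in [set` simplexes K]) hull A.

Definition subdivision K' K : Prop :=
  polyhedron K' = polyhedron K /\
  forall A, A \in simplexes K' ->
    exists2 B, B \in simplexes K & (hull A `<=` hull B)%classic.

(* K' = (A, a)K for some nonempty simplex A of K and some a interior to A *)
Definition stellar_subdivision K' K : Prop :=
  exists (A : {fset 'rV[R]_N}) (a : 'rV[R]_N),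
    [/\ A \in simplexes K, A != fset0, simplex_interior A a
      & simplexes K' = stellar A a K].

End Subdivision.

Definition pl_homeomorphic (R : realType) (N M : nat)
    (K : complex R N) (L : complex R M) : Prop :=
  exists (K' : complex R N) (L' : complex R M),
    [/\ subdivision K' K, subdivision L' L & simplicial_isomorphic K' L'].

Inductive stellar_move (R : realType) :
    forall N M : nat, complex R N -> complex R M -> Prop :=
| move_subdivision N (K K' : complex R N) :
    stellar_subdivision K' K -> stellar_move K K'
| move_weld N (K K' : complex R N) :
    stellar_subdivision K' K -> stellar_move K' K
| move_isomorphism N M (K : complex R N) (L : complex R M) :
    simplicial_isomorphic K L -> stellar_move K L.

(* The intermediate complexes may lie in Euclidean spaces of any dimension. *)
Inductive stellar_equivalent (R : realType) :
    forall N M : nat, complex R N -> complex R M -> Prop :=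
| stellar_refl N (K : complex R N) : stellar_equivalent K K
| stellar_step N1 N2 N3 (K1 : complex R N1) (K2 : complex R N2)
    (K3 : complex R N3) :
    stellar_move K1 K2 -> stellar_equivalent K2 K3 -> stellar_equivalent K1 K3.

(* Main.v *)
(** Cutting a complex K along the zero set of an affine function, by starring
    the crossing edges, is a sequence of stellar subdivisions. Cutting along all
    the hyperplanes that bound the simplexes of a complex L with |K| = |L| thus
    gives an iterated stellar subdivision of K that subdivides L. Since a
    subdivision can be carried along a simplicial isomorphism, being piecewise
    linearly homeomorphic is preserved by stellar moves and welds.

    For the converse it is enough that K ~ K' for every subdivision K' of K. Call
    a subdivision T of K regular if some function on its vertices is strictly
    convex across T inside every simplex of K. An iterated stellar subdivision of
    K' is regular over K' (push the new vertices slightly down); if moreover no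
    wall of K' crosses a simplex of T, adding the absolute values of the affine
    functions that bound the simplexes of K' makes T regular over K. A regular
    subdivision T of K is stellar equivalent to the derived subdivision of K: take
    the simplexes s of K by decreasing dimension and let a point sink from height
    +oo above a generic p in s. The facets of T in s leave the lower hull one by
    one, each by a bistellar flip, that is, a stellar subdivision followed by a
    weld with the same result; in the end T inside s is replaced by the cone from
    p over the boundary of s. Both T and K, which is regular over itself, are
    therefore equivalent to the derived subdivision of K, hence
    K' ~ T ~ K. *)

Require Import Defs.
From HB Require Import structures.
From mathcomp Require Import all_boot all_order all_algebra.
From mathcomp Require Import finmap.
From mathcomp Require Import boolp classical_sets functions reals.
From mathcomp Require Import ring lra zify.

Set Implicit Arguments.
Unset Strict Implicit.
Unset Printing Implicit Defensive.

Import Order.TTheory GRing.Theory Num.Theory.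
Local Open Scope fset_scope.
Local Open Scope ring_scope.

(** The obstacle is that an arbitrary subdivision of a simplex need not be shellable, so it cannot
    be taken apart facet by facet. Strict convexity supplies an order on the facets: the heights of
    their supporting affine functions over the generic point p. The signs of the barycentric
    coordinates of p in a facet F then split its vertices into the two halves of a flip: across the
    face opposite to a positive vertex lies a facet that leaves later, or the boundary of s; across
    the face opposite to a negative vertex lies one that has already left.

    The simplexes s are taken by decreasing dimension so that what is joined to F is the same for
    all facets of s, namely the chains of barycenters of simplexes of K above s. One flip therefore
    changes the whole star of F at once.

    The stages in between are kept as abstract complexes on the vertices of T and the barycenters. A
    flip depends on incidences only, and stellar equivalence may pass through spaces of any
    dimension, so no embedding of a stage has to be followed. *)

Section Small.
Variable R : realFieldType.

(** Finitely many strict inequalities can be perturbed at once: each is shown for small [e],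
    [small_all] and [small_fset] combine the bounds, and [small_exists] picks one [e] at the end. *)
Definition small (Q : R -> Prop) : Prop :=
  exists2 d, 0 < d & forall e, 0 < e -> e <= d -> Q e.

Lemma small_and (Q1 Q2 : R -> Prop) :
  small Q1 -> small Q2 -> small (fun e => Q1 e /\ Q2 e).
Proof.
move=> [d1 d1_gt0 H1] [d2 d2_gt0 H2]; exists (Num.min d1 d2).
  by rewrite lt_min d1_gt0 d2_gt0.
by move=> e e_gt0; rewrite le_min => /andP[le1 le2]; split; [apply: H1|apply: H2].
Qed.

Lemma small_mono (Q1 Q2 : R -> Prop) :
  (forall e, 0 < e -> Q1 e -> Q2 e) -> small Q1 -> small Q2.
Proof. by move=> sub [d d_gt0 H]; exists d => // e e0 le; apply/sub/H. Qed.

Lemma small_true (Q : R -> Prop) : (forall e, 0 < e -> Q e) -> small Q.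
Proof. by move=> H; exists 1 => // e e0 _; apply: H. Qed.

Lemma small_all (I : eqType) (s : seq I) (Q : I -> R -> Prop) :
  (forall i, i \in s -> small (Q i)) -> small (fun e => forall i, i \in s -> Q i e).
Proof.
elim: s => [|i s IH] H; first by apply: small_true.
have Hs j : j \in s -> small (Q j) by move=> js; apply: H; rewrite inE js orbT.
have := small_and (H i (mem_head _ _)) (IH Hs).
by apply: small_mono => e _ [Qi Qs] j; rewrite inE => /predU1P[->|/Qs].
Qed.

Lemma small_fset (I : choiceType) (A : {fset I}) (Q : I -> R -> Prop) :
  (forall i, i \in A -> small (Q i)) -> small (fun e => forall i, i \in A -> Q i e).
Proof. exact: (@small_all _ (enum_fset A)). Qed.

Lemma small_le (b : R) : 0 < b -> small (fun e => e <= b).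
Proof. by move=> b0; exists b. Qed.

Lemma small_exists (Q : R -> Prop) : small Q -> exists2 e, 0 < e & Q e.
Proof. by case=> d d0 H; exists d => //; apply: H. Qed.

Lemma small_gt0 (a b : R) : 0 < a -> small (fun e => 0 < a + e * b).
Proof.
move=> a0; have [b0|b0] := leP 0 b.
  by apply: small_true => e e0; rewrite ltr_wpDr // mulr_ge0 // ltW.
have nb0 : 0 < - b by rewrite oppr_gt0.
(* Half of the root [a / - b], so that the inequality is still strict at the bound itself. *)
exists (a / (2 * - b)); first by rewrite divr_gt0 // mulr_gt0.
move=> e e0; rewrite ler_pdivlMr ?mulr_gt0 // => le.
by nra.
Qed.

Lemma small_ltD (a b a' b' : R) :
  a < a' -> small (fun e => a + e * b < a' + e * b').
Proof.
rewrite -subr_gt0 => aa'; apply: small_mono (small_gt0 (b' - b) aa') => e _.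
by nra.
Qed.

(** Here [a] and [b] stand for the values of an affine function at the ends of a segment;
    [generic_point] uses this to leave one hyperplane without entering another. *)
Lemma small_neq0 (a b : R) : (a != 0) || (b != 0) ->
  small (fun e => (1 - e) * a + e * b != 0).
Proof.
have [->|a0 _] := eqVneq a 0 => /=.
  by move=> b0; apply: small_true => e e0; rewrite mulr0 add0r mulf_neq0 // lt0r_neq0.
have [a0'|a0'] := ltP 0 a.
  apply: small_mono (small_gt0 (b - a) a0') => e _ lt; apply/lt0r_neq0.
  by nra.
have na0 : 0 < - a by rewrite oppr_gt0 lt_neqAle a0.
apply: small_mono (small_gt0 (a - b) na0) => e _ lt; apply/ltr0_neq0.
by nra.
Qed.

End Small.

(** * Affine functions and homogeneous coordinates *)

Section Affine.
Variables (R : realType) (N : nat).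
Local Notation P := 'rV[R]_N.
Implicit Types (A B : {fset P}) (c d : P -> R) (x y : P).

(** Combinations are indexed by arbitrary sequences, so that sums over the vertices of a simplex and
    two-term segments are both instances. *)
Definition affine (phi : P -> R) : Prop :=
  forall (I : Type) (r : seq I) (c : I -> R) (p : I -> P), \sum_(i <- r) c i = 1 ->
    phi (\sum_(i <- r) c i *: p i) = \sum_(i <- r) c i * phi (p i).

Definition segm (e : R) x y := (1 - e) *: x + e *: y.

Lemma affine_segm phi e x y : affine phi ->
  phi (segm e x y) = (1 - e) * phi x + e * phi y.
Proof.
move=> aff; have := @aff bool [:: true; false]
  (fun b => if b then 1 - e else e) (fun b => if b then x else y).
by rewrite !big_cons !big_nil !addr0 subrK; apply.
Qed.

Lemma affineD phi psi : affine phi -> affine psi -> affine (fun x => phi x + psi x).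
Proof.
move=> H1 H2 I r c p c1; rewrite H1 // H2 // -big_split /=.
by apply: eq_bigr => i _; rewrite mulrDr.
Qed.

Lemma affineZ a phi : affine phi -> affine (fun x => a * phi x).
Proof.
move=> H I r c p c1; rewrite H // mulr_sumr.
by apply: eq_bigr => i _; rewrite mulrCA.
Qed.

Lemma affine0 : affine (fun=> 0).
Proof. by move=> I r c p _; rewrite big1 // => i _; rewrite mulr0. Qed.

Lemma affine_sum (J : Type) (s : seq J) (f : J -> P -> R) :
  (forall j, affine (f j)) -> affine (fun x => \sum_(j <- s) f j x).
Proof.
move=> H; elim: s => [|j s IH].
  by move=> I r c p c1; rewrite big_nil big1 // => i _; rewrite big_nil mulr0.
move=> I r c p c1; rewrite big_cons H // IH // -big_split /=.
by apply: eq_bigr => i _; rewrite big_cons mulrDr.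
Qed.

(** The appended coordinate 1 makes affine combinations linear: affine independence, span and
    dimension become [free], [hspan] and [\dim]. *)
Definition homog x : 'rV[R]_(N + 1) := row_mx x (const_mx 1).

Lemma homog_sum (I : Type) (r : seq I) (c : I -> R) (p : I -> P) :
  \sum_(i <- r) c i = 1 ->
  homog (\sum_(i <- r) c i *: p i) = \sum_(i <- r) c i *: homog (p i).
Proof.
move=> c1; rewrite /homog.
transitivity (row_mx (\sum_(i <- r) c i *: p i)
    (\sum_(i <- r) c i *: (const_mx 1 : 'M[R]_(1, 1)))).
  by rewrite -scaler_suml c1 scale1r.
elim: r {c1} => [|i r IH]; first by rewrite !big_nil row_mx0.
by rewrite !big_cons -IH scale_row_mx add_row_mx.
Qed.

Lemma homog_comb (I : Type) (r : seq I) (c : I -> R) (p : I -> P) x :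
  homog x = \sum_(i <- r) c i *: homog (p i) ->
  \sum_(i <- r) c i = 1 /\ x = \sum_(i <- r) c i *: p i.
Proof.
move=> E; have {}E : homog x = row_mx (\sum_(i <- r) c i *: p i)
    (const_mx (\sum_(i <- r) c i)).
  rewrite E /homog; elim: r {E} => [|i r IH].
    by rewrite !big_nil -[const_mx 0]/(0 : 'M__) row_mx0.
  rewrite !big_cons IH scale_row_mx add_row_mx; congr row_mx.
  by apply/matrixP => a b; rewrite !mxE mulr1.
move/eq_row_mx: E => [Ex E1]; split=> //.
by move/matrixP: E1 => /(_ 0 0); rewrite !mxE => <-.
Qed.

Lemma homog_inj : injective homog.
Proof. by move=> x y /eq_row_mx[]. Qed.

Lemma affine_homog (f : {linear 'rV[R]_(N + 1) -> R^o}) :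
  affine (fun x => f (homog x)).
Proof.
move=> I r c p c1; rewrite homog_sum // linear_sum.
by apply: eq_bigr => i _; rewrite linearZ.
Qed.

Definition hspan A : {vspace 'rV[R]_(N + 1)} := <<map homog A>>%VS.

Lemma hspanP A x :
  reflect (exists2 c, \sum_(v <- A) c v = 1 & x = \sum_(v <- A) c v *: v)
          (homog x \in hspan A).
Proof.
apply: (iffP idP) => [|[c c1 ->]]; last first.
  rewrite homog_sum // big_seq; apply: memv_suml => v vA.
  by apply/memvZ/memv_span/map_f.
rewrite /hspan; set X := map _ _; move=> /(coord_span (X := in_tuple X)) E.
(* [coord] is indexed by positions in [X]; [k] regroups these coordinates by vertex. *)
pose k := fun v => \sum_(i < size X | X`_i == homog v) coord (in_tuple X) i (homog x).
have {}E : homog x = \sum_(v <- A) k v *: homog v.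
  rewrite {1}E [RHS](_ : _ = \sum_(v <- A) \sum_(i < size X)
    if X`_i == homog v then coord (in_tuple X) i (homog x) *: X`_i else 0); last first.
    apply: eq_bigr => v _; rewrite /k scaler_suml big_mkcond.
    by apply: eq_bigr => i _; case: eqP => [->|].
  rewrite exchange_big /=; apply: eq_bigr => i _.
  have /mapP[v vA Ev] : X`_i \in X by rewrite mem_nth.
  rewrite (bigD1_seq v) //= ?fset_uniq // Ev eqxx big1 ?addr0 // => u uv.
  by case: eqP => // /homog_inj Eu; rewrite Eu eqxx in uv.
have [c1 ->] := homog_comb E.
by exists k.
Qed.

Lemma free_homog A : affinely_independent A -> free (map homog A).
Proof.
move=> indA; pose X := in_tuple (map homog A).
rewrite -[map _ _]/(tval X); apply/freeP => k Ek i.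
have sz : size (map homog A) = size A by rewrite size_map.
have iA : (i < size A)%N by rewrite -sz.
pose c v := k (insubd i (index v A)).
have cE j : c (nth 0 A (val j)) = k j.
  rewrite /c index_uniq ?fset_uniq ?(leq_trans (ltn_ord j)) ?sz //.
  by congr k; apply: val_inj; rewrite val_insubd ltn_ord.
have E0 : \sum_(v <- A) c v *: homog v = 0.
  rewrite (big_nth 0) big_mkord -sz -[RHS]Ek; apply: eq_bigr => j _.
  by rewrite cE (nth_map 0) // -sz.
have E1 : \sum_(v <- A) c v = 0 /\ \sum_(v <- A) c v *: v = 0.
  suff /eq_row_mx[-> E2] : row_mx (\sum_(v <- A) c v *: v) (const_mx (\sum_(v <- A) c v)) =
    row_mx 0 (0 : 'M[R]_(1,1)).
    by split=> //; move/matrixP: E2 => /(_ 0 0); rewrite !mxE.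
  rewrite row_mx0 -E0; elim: (enum_fset A) => [|v s IH].
    by rewrite !big_nil -[const_mx 0]/(0 : 'M__) row_mx0.
  rewrite !big_cons -IH scale_row_mx add_row_mx; congr row_mx.
  by apply/matrixP => a b; rewrite !mxE mulr1.
rewrite -cE; case: E1 => s0 v0; apply: indA s0 v0 _ _.
exact: mem_nth.
Qed.

(** A linear map may be prescribed on the free family of the [homog v]; composed with [homog] it is
    affine on the whole space, off the span of [A] as well. *)
Lemma affine_coord A : affinely_independent A ->
  exists lam : P -> P -> R, (forall v, affine (lam v)) /\
    (forall u v, u \in A -> lam v u = (u == v)%:R).
Proof.
move=> /free_homog fA.
pose fX v : seq R^o := map (fun u => (u == v)%:R) A.
have key v : {f : {linear 'rV[R]_(N + 1) -> R^o} | map f (map homog A) = fX v}.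
  have [f Ef] := linear_of_free (map homog A) (fX v).
  by exists f; apply: Ef; rewrite ?size_map.
pose f v := sval (key v).
exists (fun v x => f v (homog x)); split=> [v|u v uA]; first exact: affine_homog.
have E := svalP (key v); rewrite -[sval _]/(f v) in E.
rewrite -map_comp in E.
by have /eq_in_map/(_ u uA) := E.
Qed.

(** The span is cut out by the entries of [z - projv U z]. Each is listed with both signs, because
    membership is tested only through [0 <= l x]. *)
Lemma affine_span_equations A : exists ls : seq (P -> R),
  [/\ forall l, l \in ls -> affine l,
      forall l v, l \in ls -> v \in A -> l v = 0 &
      forall x, (forall l, l \in ls -> 0 <= l x) -> homog x \in hspan A].
Proof.
pose U := hspan A.
pose g (e : R) j (z : 'rV[R]_(N + 1)) : R^o := e * (z - projv U z) 0 j.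
have lg e j : linear (g e j).
  by move=> a u v; rewrite /g linearP /= !mxE /GRing.scale /=; ring.
pose gL e j : {linear 'rV[R]_(N + 1) -> R^o} :=
  HB.pack (g e j) (GRing.isLinear.Build _ _ _ _ (g e j) (lg e j)).
pose l e j : P -> R := fun x => g e j (homog x).
exists ([seq l 1 j | j <- enum 'I_(N + 1)] ++ [seq l (-1) j | j <- enum 'I_(N + 1)]).
split=> [f|f v|x H].
- by rewrite mem_cat => /orP[] /mapP[j _ ->]; apply: (affine_homog (gL _ j)).
- rewrite mem_cat => /orP[] /mapP[j _ ->] vA;
    by rewrite /l /g projv_id ?subrr ?mxE ?mulr0 // memv_span // map_f.
- suff -> : homog x = projv U (homog x) by apply: memv_proj.
  apply/eqP; rewrite -subr_eq0; apply/eqP/matrixP => i j; rewrite ord1 [RHS]mxE.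
  apply/eqP; rewrite eq_le; apply/andP; split.
    rewrite -oppr_ge0 -mulN1r; apply: (H (l (-1) j)).
    by rewrite mem_cat map_f ?orbT // mem_enum.
  rewrite -[leRHS]mul1r; apply: (H (l 1 j)).
  by rewrite mem_cat map_f // mem_enum.
Qed.

End Affine.

(** * Barycentric coordinates *)

Section Barycentric.
Variables (R : realType) (N : nat).
Local Notation P := 'rV[R]_N.
Implicit Types (A B : {fset P}) (c d : P -> R) (x y : P).

(** In contrast to [hull], the coordinates vanish off [A], so that coordinates of one point over two
    simplexes can be compared as functions. *)
Definition bary A c x : Prop :=
  [/\ forall v, v \in A -> 0 <= c v, forall v, v \notin A -> c v = 0,
      \sum_(v <- A) c v = 1 & x = \sum_(v <- A) c v *: v].

Lemma hullP A x : hull A x <-> exists c, bary A c x.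
Proof.
split=> [[c [c0 c1 ->]]|[c [c0 _ c1 ->]]]; last by exists c.
exists (fun v => if v \in A then c v else 0); split=> [v|v||].
- by move=> vA; rewrite vA c0.
- by move=> /negbTE ->.
- by rewrite -c1; apply: eq_big_seq => v ->.
- by apply: eq_big_seq => v ->.
Qed.

Lemma interiorP A x : simplex_interior A x <->
  exists2 c, bary A c x & forall v, v \in A -> 0 < c v.
Proof.
split=> [[c [c0 c1 ->]]|[c [_ _ c1 ->] c0]]; last by exists c.
exists (fun v => if v \in A then c v else 0); last by move=> v vA; rewrite vA c0.
split=> [v vA|v /negbTE ->||] //; first by rewrite vA ltW ?c0.
- by rewrite -c1; apply: eq_big_seq => v ->.
- by apply: eq_big_seq => v ->.
Qed.

Lemma bary_ge0 A c x v : bary A c x -> 0 <= c v.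
Proof. by case=> c0 c0' _ _; have [/c0|/c0' ->] := boolP (v \in A). Qed.

Lemma bary_out A c x v : bary A c x -> v \notin A -> c v = 0.
Proof. by case=> _ + _ _; apply. Qed.

Lemma bary_sub A B c x : A `<=` B -> bary A c x -> bary B c x.
Proof.
move=> sAB bc; have [_ out c1 xE] := bc; split=> [v _|v vB||].
- exact: bary_ge0 bc.
- by apply: out; apply: contraNN vB; apply/fsubsetP.
- by rewrite -c1; apply/esym/big_fset_incl => // v _ /out.
- by rewrite xE; apply: big_fset_incl => // v _ /out ->; rewrite scale0r.
Qed.

Lemma bary_restrict A B c x :
  bary A c x -> (forall v, v \notin B -> c v = 0) -> bary B c x.
Proof.
move=> bc out; have [_ outA c1 xE] := bary_sub (fsubsetUl A B) bc.
split=> // [v _||]; first exact: bary_ge0 bc.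
- by rewrite -c1; apply/big_fset_incl => //; rewrite ?fsubsetUr // => v _ /out.
- rewrite xE; apply/esym/big_fset_incl; first exact: fsubsetUr.
  by move=> v _ /out ->; rewrite scale0r.
Qed.

Lemma affine_bary phi A c x : affine phi -> bary A c x ->
  phi x = \sum_(v <- A) c v * phi v.
Proof. by move=> aff [_ _ c1 ->]; apply: aff. Qed.

Lemma bary_vertex v : bary [fset v] (fun u => (u == v)%:R) v.
Proof.
split=> [u _|u||]; rewrite ?big_seq_fset1 ?eqxx ?scale1r ?ler0n //.
by rewrite inE => /negbTE ->.
Qed.

Lemma hull_vertex A v : v \in A -> hull A v.
Proof.
move=> vA; apply/hullP; exists (fun u => (u == v)%:R).
by apply: bary_sub (bary_vertex v); rewrite fsub1set.
Qed.

Lemma hull_sub A B x : A `<=` B -> hull A x -> hull B x.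
Proof. by move=> sAB /hullP[c bc]; apply/hullP; exists c; apply: bary_sub bc. Qed.

Lemma hull_fset0 x : ~ hull fset0 x.
Proof. by case=> c [_ ]; rewrite big_seq_fset0 => /eqP; rewrite eq_sym oner_eq0. Qed.

Lemma bary_join (I : choiceType) (A : {fset I}) B (c : I -> R)
    (d : I -> P -> R) (F : I -> P) :
  (forall v, v \in A -> 0 <= c v) -> \sum_(v <- A) c v = 1 ->
  (forall v, v \in A -> bary B (d v) (F v)) ->
  bary B (fun u => \sum_(v <- A) c v * d v u) (\sum_(v <- A) c v *: F v).
Proof.
move=> c0 c1 bd; split=> [u uB|u uB||].
- rewrite big_seq sumr_ge0 // => v vA; rewrite mulr_ge0 ?c0 //.
  exact: bary_ge0 (bd v vA).
- by rewrite big_seq big1 // => v vA; rewrite (bary_out (bd v vA)) // mulr0.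
- rewrite exchange_big -c1 /=; apply: eq_big_seq => v vA.
  by rewrite -mulr_sumr; case: (bd v vA) => _ _ ->; rewrite mulr1.
- under [RHS]eq_bigr => u _ do rewrite scaler_suml.
  rewrite exchange_big /=; apply: eq_big_seq => v vA.
  have [_ _ _ ->] := bd v vA; rewrite scaler_sumr.
  by apply: eq_bigr => u _; rewrite scalerA.
Qed.

Lemma hull_comb (I : choiceType) (A : {fset I}) B (c : I -> R) (F : I -> P) :
  (forall v, v \in A -> 0 <= c v) -> \sum_(v <- A) c v = 1 -> (forall v, v \in A -> hull B (F v)) ->
  hull B (\sum_(v <- A) c v *: F v).
Proof.
move=> c0 c1 H.
have /choice[d dP] v : exists d, v \in A -> bary B d (F v).
  have [/H/hullP[d bd]|] := boolP (v \in A); first by exists d.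
  by exists (fun=> 0).
by apply/hullP; eexists; apply: (bary_join c0 c1 dP).
Qed.

Lemma hull_hull A B x : (forall v, v \in A -> hull B v) -> hull A x -> hull B x.
Proof. by move=> H [c [c0 c1 ->]]; apply: (hull_comb (F := id)). Qed.

Lemma hull_segm A x y e : 0 <= e -> e <= 1 -> hull A x -> hull A y ->
  hull A (segm e x y).
Proof.
move=> e0 e1 /hullP[c [c0 _ c1 ->]] /hullP[d [d0 _ d1 ->]].
exists (fun v => (1 - e) * c v + e * d v); split=> [v vA||].
- by rewrite addr_ge0 ?mulr_ge0 ?subr_ge0 ?c0 ?d0.
- by rewrite big_split /= -!mulr_sumr c1 d1 !mulr1 subrK.
- rewrite /segm !scaler_sumr -big_split; apply: eq_bigr => v _ /=.
  by rewrite !scalerA scalerDl.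
Qed.

Definition center A : P := \sum_(v <- A) #|` A|%:R^-1 *: v.

Lemma bary_center A : A != fset0 ->
  exists2 c, bary A c (center A) & forall v, v \in A -> 0 < c v.
Proof.
rewrite -cardfs_gt0 => cA; apply/interiorP.
exists (fun=> #|` A|%:R^-1); split=> [v _||//]; first by rewrite invr_gt0 ltr0n.
have nz : #|` A|%:R != 0 :> R by rewrite pnatr_eq0 -lt0n.
rewrite big_const_seq count_predT iter_addr addr0 -[LHS]mulr_natl.
exact: divff nz.
Qed.

Lemma bary_eqin A c d x : affinely_independent A ->
  bary A c x -> bary A d x -> c = d.
Proof.
move=> indA bc bd; apply/funext => v.
have [vA|vA] := boolP (v \in A); last by rewrite (bary_out bc) // (bary_out bd).
have [_ _ c1 xc] := bc; have [_ _ d1 xd] := bd.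
apply/eqP; rewrite -subr_eq0; apply/eqP.
apply: (indA (fun v => c v - d v)) => //; first by rewrite sumrB c1 d1 subrr.
by under eq_bigr => u _ do rewrite scalerBl; rewrite sumrB -xc -xd subrr.
Qed.

(** The point also has coordinates over the common face given by [simplexes_meet]; these agree with
    [c] inside [A] and with [d] inside [B]. *)
Lemma bary_eq (K : complex R N) A B c d x : A \in simplexes K -> B \in simplexes K ->
  bary A c x -> bary B d x -> c = d.
Proof.
move=> AK BK bA bB.
have [C [CA CB EC]] := simplexes_meet AK BK.
have : hull C x by rewrite -EC; split; apply/hullP; [exists c|exists d].
case/hullP=> e be; transitivity e.
  exact: bary_eqin (simplexes_independent AK) bA (bary_sub CA be).
exact: bary_eqin (simplexes_independent BK) (bary_sub CB be) bB.
Qed.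

Lemma bary_support (K : complex R N) A B c x : A \in simplexes K -> B \in simplexes K ->
  bary A c x -> (forall v, v \in A -> 0 < c v) -> hull B x -> A `<=` B.
Proof.
move=> AK BK bA c0 /hullP[d bB]; apply/fsubsetP => v vA.
have E := bary_eq AK BK bA bB.
by apply: contraLR (c0 v vA) => vB; rewrite E (bary_out bB) // ltxx.
Qed.

Lemma hullI (K : complex R N) A B x : A \in simplexes K -> B \in simplexes K ->
  hull A x -> hull B x -> hull (A `&` B) x.
Proof.
move=> AK BK /hullP[c bA] /hullP[d bB].
have E := bary_eq AK BK bA bB; apply/hullP; exists c; apply: (bary_restrict bA).
move=> v; rewrite inE negb_and => /orP[vA|vB]; last by rewrite E (bary_out bB).
by case: bA => _ ->.
Qed.

Lemma vertex_hull (K : complex R N) A v : A \in simplexes K ->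
  [fset v] \in simplexes K -> hull A v -> v \in A.
Proof.
move=> AK vK hv; rewrite -fsub1set.
apply: (bary_support vK AK (bary_vertex v)) => // u; rewrite inE => /eqP ->.
by rewrite eqxx ltr01.
Qed.

Lemma carrier (K : complex R N) A x : A \in simplexes K -> hull A x ->
  exists B c, [/\ B \in simplexes K, B `<=` A, bary B c x & forall v, v \in B -> 0 < c v].
Proof.
move=> AK /hullP[c bc]; exists [fset v in A | 0 < c v], c.
have sBA : [fset v in A | 0 < c v] `<=` A by apply/fsubsetP => v; rewrite !inE => /andP[].
split=> //; first exact: simplexes_face AK sBA.
  apply: (bary_restrict bc) => v; rewrite !inE negb_and.
  case: (boolP (v \in A)) => [_ /=|vA _]; last by case: bc => _ ->.
  by rewrite lt_neqAle (bary_ge0 v bc) andbT negbK => /eqP.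
by move=> v; rewrite !inE => /andP[].
Qed.

End Barycentric.

(** * Complexes from families with unique barycentric coordinates *)

Definition face_closed (V : choiceType) (K : {fset {fset V}}) : Prop :=
  forall A B : {fset V}, A \in K -> B `<=` A -> B \in K.

Lemma complex_face_closed (R : realType) (N : nat) (K : complex R N) :
  face_closed (simplexes K).
Proof. exact: simplexes_face. Qed.

Section MakeComplex.
Variables (R : realType) (N : nat) (K : {fset {fset 'rV[R]_N}}).
Hypothesis clK : face_closed K.
Hypothesis uniqK : forall A B c d x, A \in K -> B \in K ->
  bary A c x -> bary B d x -> c = d.

(** A small multiple of an affine dependency could be added to the positive coordinates of the
    barycenter, which would give it a second system of coordinates. *)
Lemma independent_of_bary A : A \in K -> affinely_independent A.
Proof.
move=> AK c s0 v0 v vA.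
have A0 : A != fset0 by apply/fset0Pn; exists v.
have [d bd d0] := bary_center A0.
pose c' u := if u \in A then c u else 0.
have : small (fun e => forall u, u \in A -> 0 < d u + e * c' u).
  by apply: (@small_fset _ _ A (fun u e => 0 < d u + e * c' u)) => u uA; exact/small_gt0/d0.
case/small_exists=> e e0 de.
have : bary A (fun u => d u + e * c' u) (center A).
  have [_ out d1 xE] := bd; split=> [u uA|u uA||].
  - by apply/ltW/de.
  - by rewrite (out u uA) /c' (negbTE uA) mulr0 addr0.
  - rewrite big_split /= d1 -mulr_sumr (eq_big_seq c) ?s0 ?mulr0 ?addr0 //.
    by move=> u; rewrite /c' => ->.
  - rewrite (eq_bigr (fun u => d u *: u + e *: (c' u *: u))); last first.
      by move=> u _; rewrite scalerDl scalerA.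
    rewrite big_split /= -scaler_sumr -xE (eq_big_seq (fun u => c u *: u)).
      by rewrite v0 scaler0 addr0.
    by move=> u; rewrite /c' => ->.
move=> be; have /(congr1 (fun f => f v)) := uniqK AK AK bd be.
rewrite /c' vA -[LHS]addr0 => /addrI/esym/eqP.
by rewrite mulf_eq0 (gt_eqF e0) => /eqP.
Qed.

Lemma meet_of_bary A B : A \in K -> B \in K ->
  exists C, [/\ C `<=` A, C `<=` B & (hull A `&` hull B)%classic = hull C].
Proof.
move=> AK BK; exists (A `&` B); split; rewrite ?fsubsetIl ?fsubsetIr //.
apply/seteqP; split=> [x [/hullP[c bA] /hullP[d bB]]|x hx]; last first.
  by split; apply: hull_sub hx; rewrite ?fsubsetIl ?fsubsetIr.
have E := uniqK AK BK bA bB; apply/hullP; exists c; apply: (bary_restrict bA).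
move=> v; rewrite inE negb_and => /orP[vA|vB]; last by rewrite E (bary_out bB).
by case: bA => _ ->.
Qed.

(** Every new complex below is built this way: uniqueness of coordinates yields both independence
    and the condition on intersections. *)
Definition complex_of_bary : complex R N :=
  @Complex R N K independent_of_bary clK meet_of_bary.

End MakeComplex.

(** * Simplexes of a stellar subdivision *)

Section StellarMembership.
Variable V : choiceType.
Implicit Types (A S : {fset V}) (K : {fset {fset V}}).

Lemma starP A K S : face_closed K -> S \in star A K <-> S `|` A \in K.
Proof.
move=> clK; split.
  case/imfset2P=> F; rewrite fpowersetE => FA [G].
  rewrite !inE => /andP[_ /andP[_ AG]] ->.
  by rewrite fsetUAC (fsetUidPr _ _ FA).
move=> SA; apply/imfset2P; exists (S `&` A).
  by rewrite fpowersetE fsubsetIr.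
exists (S `\` A); last by rewrite fsetID.
rewrite !inE; apply/and3P; split.
- by apply: clK SA _; apply: fsubset_trans (fsubsetDl _ _) (fsubsetUl _ _).
- by apply/fdisjointP => v; rewrite inE => ->.
- by rewrite fsetUDl fsetDv fsetD0 fsetUC.
Qed.

Lemma in_ball A a K S : face_closed K ->
  S \in join (faces [fset a]) (join (boundary A) (link A K)) <->
  exists C T, [/\ C `<=` [fset a], S = C `|` T, T `|` A \in K & ~~ (A `<=` T)].
Proof.
move=> clK; split.
  case/imfset2P=> C; rewrite fpowersetE => Ca [T /imfset2P[D + [G + ->]] ->].
  rewrite !inE fpowersetE => /andP[DA sDA] /andP[_ /andP[dG AG]].
  exists C, (D `|` G); split=> //; first by rewrite fsetUAC (fsetUidPr _ _ sDA).
  apply: contra DA => sA; rewrite eqEfsubset sDA /=.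
  apply/fsubsetP => v vA; have := fsubsetP sA v vA; rewrite inE => /orP[//|vG].
  by move/fdisjointP: dG => /(_ v vA); rewrite vG.
move=> [C [T [Ca -> TA nA]]]; apply/imfset2P; exists C; first by rewrite fpowersetE.
exists T => //; apply/imfset2P; exists (T `&` A).
  rewrite !inE fpowersetE fsubsetIr andbT; apply: contra nA => /eqP {1}<-.
  exact: fsubsetIl.
exists (T `\` A); last by rewrite fsetID.
rewrite !inE; apply/and3P; split.
- by apply: clK TA _; apply: fsubset_trans (fsubsetDl _ _) (fsubsetUl _ _).
- by apply/fdisjointP => v; rewrite inE => ->.
- by rewrite fsetUDl fsetDv fsetD0 fsetUC.
Qed.

(** The second hypothesis admits one degenerate case, a vertex subdivided at itself, which the
    geometric definition of a subdivision allows. *)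
Lemma stellarP A a K S : face_closed K -> ([fset a] \in K -> A = [fset a]) ->
  S \in stellar A a K <->
  [/\ a \notin S, S \in K & ~~ (A `<=` S)] \/
  [/\ a \in S, (S `\ a) `|` A \in K & ~~ (A `<=` S `\ a)].
Proof.
move=> clK fresh.
have aK T : T \in K -> a \in T -> A = [fset a].
  by move=> TK aT; apply: fresh; apply: clK TK _; rewrite fsub1set.
rewrite in_fsetU in_fsetD; split.
  case/orP=> [/andP[nst SK]|/in_ball-/(_ clK)[C [T [Ca -> TA nA]]]].
    have nSA : S `|` A \notin K by apply: contra nst => /starP; apply.
    left; split=> //.
      by apply/negP => aS; case/negP: nSA; rewrite (aK _ SK aS) fsetUC (fsetUidPr _ _ _) ?fsub1set.
    by apply: contra nSA => /fsetUidPl ->.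
  have aT : a \notin T.
    apply/negP => aT; case/negP: nA; rewrite (aK _ TA) ?fsub1set //.
    by rewrite inE aT.
  move: Ca; rewrite fsubset1 => /orP[/eqP ->|/eqP ->].
    right; rewrite fsetU1K // fset1U1; split=> //.
  left; rewrite fset0U; split=> //.
  exact: clK TA (fsubsetUl _ _).
case=> [[aS SK nA]|[aS SA nA]].
  have [SA|SA] := boolP (S `|` A \in K).
    apply/orP; right; apply/in_ball=> //; exists fset0, S.
    by rewrite fsub0set fset0U.
  by rewrite SK andbT; apply/orP; left; apply: contra SA => /starP; apply.
apply/orP; right; apply/in_ball=> //; exists [fset a], (S `\ a).
by rewrite fsubset_refl fsetD1K.
Qed.

Lemma stellar_face_closed A a K : face_closed K ->
  ([fset a] \in K -> A = [fset a]) -> face_closed (stellar A a K).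
Proof.
move=> clK fresh S T /stellarP-/(_ clK fresh) HS TS; apply/stellarP => //.
have [aT|aT] := boolP (a \in T); [right|left]; last case: HS => [[aS SK nA]|[aS SA nA]].
- case: HS => [[/negP]|[aS SA nA]]; first by case; apply: (fsubsetP TS).
  split=> //; first by apply: clK SA _; apply/fsetSU/fsetSD.
  by apply: contra nA => sA; apply: fsubset_trans sA _; apply: fsetSD.
- split=> //; first exact: clK SK TS.
  by apply: contra nA => sA; apply: fsubset_trans sA TS.
- have TSa : T `<=` S `\ a by rewrite fsubsetD1 TS.
  split=> //; last by apply: contra nA => sA; apply: fsubset_trans sA TSa.
  by apply: clK SA _; apply: fsubset_trans TSa (fsubsetUl _ _).
Qed.

End StellarMembership.

(** * Stellar subdivisions are complexes and subdivisions *)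

Section StellarGeometry.
Variables (R : realType) (N : nat) (K : complex R N).
Local Notation P := 'rV[R]_N.
Variables (A : {fset P}) (a : P) (alpha : P -> R).
Hypotheses (AK : A \in simplexes K) (bA : bary A alpha a).
Hypothesis alpha0 : forall v, v \in A -> 0 < alpha v.
Implicit Types (S B : {fset P}) (c d : P -> R) (x : P).

Lemma stellar_fresh : [fset a] \in simplexes K -> A = [fset a].
Proof.
move=> aK; have sA : A `<=` [fset a].
  by apply: bary_support AK aK bA alpha0 _; apply: hull_vertex; rewrite inE.
apply/eqP; rewrite eqEfsubset sA fsub1set /=.
case: (fset_0Vmem A) => [A0|[v vA]]; last by have := fsubsetP sA v vA; rewrite inE => /eqP <-.
by case: bA => _ _; rewrite A0 big_seq_fset0 => /eqP; rewrite eq_sym oner_eq0.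
Qed.

Let stP S := stellarP S (@complex_face_closed _ _ K) stellar_fresh.

(* Substituting a = sum alpha v *: v turns coordinates over the stellar
   subdivision into coordinates over K; some v in A then has no contribution
   of its own, so d a is the minimum of (lift d) v / alpha v over A. *)
Definition stellar_lift d v := (if v == a then 0 else d v) + d a * alpha v.

Lemma stellar_lift_bary S d x : S \in stellar A a K -> bary S d x ->
  exists2 B, B \in simplexes K & bary B (stellar_lift d) x.
Proof.
move=> /stP HS bS; have [_ dS d1 xE] := bS.
have [_ outA a1 aE] := bA.
case: HS => [[aS SK nA]|[aS SA nA]].
  exists S => //; suff -> : stellar_lift d = d by [].
  apply/funext => v; rewrite /stellar_lift (dS a aS) mul0r addr0.
  by case: eqP => // ->; rewrite dS.
pose E := a |` (S `|` A); pose d0 v := if v == a then 0 else d v.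
exists ((S `\ a) `|` A) => //; apply: (bary_restrict (A := E)); last first.
  move=> v; rewrite !inE negb_or negb_and negbK => /andP[vS vA].
  rewrite /stellar_lift (outA v vA) mulr0 addr0.
  by case: eqP vS => //= _ /dS.
have sS : S `<=` E by apply: fsubset_trans (fsubsetUl _ _) (fsubsetUr _ _).
have sA : A `<=` E by apply: fsubset_trans (fsubsetUr _ _) (fsubsetUr _ _).
have [_ _ dE xdE] := bary_sub sS bS.
have [_ _ aE1 xaE] := bary_sub sA bA.
have aIE : a \in E by rewrite !inE eqxx.
split=> [v _|v vE||].
- rewrite addr_ge0 // ?mulr_ge0 ?(bary_ge0 _ bS) ?(bary_ge0 _ bA) //.
  by case: ifP => _ //; apply: bary_ge0 bS.
- have vS : v \notin S by apply: contraNN vE; apply/fsubsetP.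
  have vA : v \notin A by apply: contraNN vE; apply/fsubsetP.
  by rewrite /stellar_lift (outA _ vA) (dS _ vS) mulr0 addr0 if_same.
- rewrite big_split /= -mulr_sumr aE1 mulr1 -dE (big_fsetD1 a) //= eqxx add0r.
  rewrite addrC [RHS](big_fsetD1 a) //=; congr (_ + _).
  by apply: eq_big_seq => v; rewrite !inE => /andP[/negbTE ->].
- rewrite {1}xdE (big_fsetD1 a) //= [X in d a *: X]xaE scaler_sumr addrC.
  rewrite [RHS](eq_bigr (fun v => d0 v *: v + d a *: (alpha v *: v))); last first.
    by move=> v _; rewrite scalerDl scalerA.
  rewrite big_split /=; congr (_ + _).
  rewrite [RHS](big_fsetD1 a) //= /d0 eqxx scale0r add0r.
  by apply: eq_big_seq => v; rewrite !inE => /andP[/negbTE ->].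
Qed.

Lemma stellar_lift_zero S d x : S \in stellar A a K -> bary S d x ->
  exists2 v, v \in A & stellar_lift d v = d a * alpha v.
Proof.
move=> /stP HS [_ dS _ _].
have nA : ~~ (A `<=` S `\ a).
  case: HS => [[aS _ nA]|[]//]; apply: contra nA => sA.
  exact: fsubset_trans sA (fsubsetDl _ _).
have /fsubsetPn[v vA] := nA; rewrite !inE negb_and negbK => vS.
exists v => //; rewrite /stellar_lift; case: eqP vS => /= [|_ /dS ->];
  by rewrite add0r.
Qed.

Lemma stellar_lift_ge d S x v : bary S d x -> d a * alpha v <= stellar_lift d v.
Proof.
by move=> bS; rewrite lerDr; case: ifP => // _; apply: bary_ge0 bS.
Qed.

Lemma stellar_uniq S T c d x : S \in stellar A a K -> T \in stellar A a K ->
  bary S c x -> bary T d x -> c = d.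
Proof.
move=> SK TK bS bT.
have [B BK bB] := stellar_lift_bary SK bS.
have [C CK bC] := stellar_lift_bary TK bT.
have E := bary_eq BK CK bB bC.
have [v vA cv] := stellar_lift_zero SK bS.
have [u uA du] := stellar_lift_zero TK bT.
have Ea : c a = d a.
  apply/eqP; rewrite eq_le; apply/andP; split.
    by rewrite -(ler_pM2r (alpha0 uA)) -du -E; apply: stellar_lift_ge bS.
  by rewrite -(ler_pM2r (alpha0 vA)) -cv E; apply: stellar_lift_ge bT.
apply/funext => w; have /(congr1 (fun f => f w)) := E.
by rewrite /stellar_lift -Ea => /addIr; case: eqP => [->|].
Qed.

Definition stellar_complex : complex R N :=
  complex_of_bary (stellar_face_closed (@complex_face_closed _ _ K) stellar_fresh)
    stellar_uniq.

Lemma stellar_complexP : stellar_subdivision stellar_complex K.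
Proof.
exists A, a; split=> //; last by apply/interiorP; exists alpha.
apply/eqP => A0.
by case: bA => _ _; rewrite A0 big_seq_fset0 => /eqP; rewrite eq_sym oner_eq0.
Qed.

Lemma stellar_cover B x : B \in simplexes K -> hull B x ->
  exists2 S, S \in stellar A a K & hull S x.
Proof.
move=> BK /hullP[c bB]; have [_ outA a1 aE] := bA.
have [sAB|nAB] := boolP (A `<=` B); last first.
  exists B; last by apply/hullP; exists c.
  apply/stP; left; split=> //; apply/negP => aB; case/negP: nAB.
  have /stellar_fresh -> : [fset a] \in simplexes K.
    by apply: simplexes_face BK _; rewrite fsub1set.
  by rewrite fsub1set.
have /fset0Pn[v1 v1A] : A != fset0.
  apply/eqP => A0.
  by move: a1; rewrite A0 big_seq_fset0 => /eqP; rewrite eq_sym oner_eq0.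
have [v0 v0A vmin] : exists2 v0, v0 \in A & forall v, v \in A ->
    c v0 / alpha v0 <= c v / alpha v.
  pose F (v : A) := c (val v) / alpha (val v).
  case: (@arg_minP _ _ _ [` v1A]%fset xpredT F isT) => v _ vmin.
  by exists (val v); [apply: valP|move=> u uA; apply: (vmin [` uA]%fset)].
pose t := c v0 / alpha v0; pose d0 v := c v - t * alpha v.
have t0 : 0 <= t by rewrite divr_ge0 // ?(bary_ge0 _ bB) // ltW ?alpha0.
have d0v0 : d0 v0 = 0 by rewrite /d0 /t divfK ?subrr ?gt_eqF ?alpha0.
have d00 v : 0 <= d0 v.
  rewrite subr_ge0; have [vA|vA] := boolP (v \in A).
    by rewrite -ler_pdivlMr ?alpha0 ?vmin.
  by rewrite (outA _ vA) mulr0 (bary_ge0 _ bB).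
have outd v : v \notin B -> d0 v = 0.
  move=> vB; rewrite /d0 (bary_out bB) // outA ?mulr0 ?subr0 //.
  by apply: contraNN vB; apply/fsubsetP.
exists (a |` (B `\ v0)).
  apply/stP; right; rewrite fset1U1; split=> //.
    apply: simplexes_face BK _; rewrite fsubUset sAB andbT.
    by apply/fsubsetP => v; rewrite !inE; case: eqP => //= _ /andP[].
  apply/negP => /fsubsetP/(_ v0 v0A); rewrite !inE eqxx /= orbF.
  by case: eqP.
apply/hullP; exists (fun v => d0 v + (v == a)%:R * t).
apply: (bary_restrict (A := a |` B)); last first.
  move=> v; rewrite !inE negb_or negb_and negbK => /andP[/negbTE -> vB].
  by rewrite mul0r addr0; case/orP: vB => [/eqP ->|/outd].
have [_ _ cE xcE] := bary_sub (fsubsetUr [fset a] B) bB.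
have sA : A `<=` a |` B by apply: fsubset_trans sAB (fsubsetUr _ _).
have [_ _ aE1 xaE] := bary_sub sA bA.
have aIE : a \in a |` B by rewrite !inE eqxx.
split=> [v _|v||].
- by rewrite addr_ge0 // mulr_ge0 ?ler0n.
- by rewrite !inE negb_or => /andP[/negbTE -> /outd ->]; rewrite mul0r addr0.
- rewrite big_split /= -mulr_suml big_split /= sumrN -mulr_sumr cE aE1.
  rewrite (big_fsetD1 a) //= eqxx big_seq big1 ?addr0 ?mulr1 ?mul1r ?subrK //.
  by move=> v; rewrite !inE => /andP[/negbTE ->].
- transitivity (\sum_(v <- a |` B) (c v *: v - t *: (alpha v *: v) + ((v == a)%:R * t) *: v)).
    rewrite big_split /= sumrB -scaler_sumr -xcE -xaE.
    rewrite (big_fsetD1 a) //= eqxx mul1r big_seq big1 ?addr0 ?subrK //.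
    by move=> v; rewrite !inE => /andP[/negbTE ->]; rewrite mul0r scale0r.
  by apply: eq_bigr => v _; rewrite !scalerDl scaleNr scalerA.
Qed.

Lemma stellar_hull S : S \in stellar A a K ->
  exists2 B, B \in simplexes K & (forall v, v \in S -> hull B v).
Proof.
case/stP => [[_ SK _]|[aS SA _]].
  by exists S => // v; apply: hull_vertex.
exists ((S `\ a) `|` A) => // v vS; have [->|va] := eqVneq v a.
  by apply: (hull_sub (fsubsetUr _ _)); apply/hullP; exists alpha.
by apply: hull_vertex; rewrite !inE va vS.
Qed.

End StellarGeometry.

(** * Subdivisions and cutting along hyperplanes *)

Section Subdivisions.
Variables (R : realType) (N : nat).
Implicit Types (K L T : complex R N).

Lemma subdivisionP T K : subdivision T K <->
  (forall S, S \in simplexes T -> exists2 B, B \in simplexes K &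
     forall v, v \in S -> hull B v) /\
  (forall B x, B \in simplexes K -> hull B x ->
     exists2 S, S \in simplexes T & hull S x).
Proof.
split=> [[E H]|[H1 H2]].
  split=> [S /H[B BK sSB]|B x BK Bx].
    by exists B => // v vS; apply/sSB/hull_vertex.
  have : polyhedron T x by rewrite E; exists B.
  by case=> S ST Sx; exists S.
have H S : S \in simplexes T -> exists2 B, B \in simplexes K & (hull S `<=` hull B)%classic.
  by move=> /H1[B BK SB]; exists B => // x; apply: hull_hull.
split=> //; apply/seteqP; split=> x [S SK Sx].
  by have [B BK sSB] := H S SK; exists B => //; apply: sSB.
by have [B BT Bx] := H2 S x SK Sx; exists B.
Qed.

Lemma subdivision_refl K : subdivision K K.
Proof. by split=> // A AK; exists A. Qed.

Lemma subdivision_trans T K L : subdivision T K -> subdivision K L -> subdivision T L.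
Proof.
move=> [E1 H1] [E2 H2]; split; first by rewrite E1.
move=> A /H1[B /H2[C CL sBC] sAB]; exists C => //.
exact: subset_trans sAB sBC.
Qed.

Lemma stellar_subdivisionP T K : stellar_subdivision T K <->
  exists A a alpha, [/\ A \in simplexes K, bary A alpha a,
    forall v, v \in A -> 0 < alpha v & simplexes T = stellar A a K].
Proof.
split=> [[A [a [AK _ /interiorP[alpha bA a0] E]]]|[A [a [alpha [AK bA a0 E]]]]].
  by exists A, a, alpha.
exists A, a; split=> //; last by apply/interiorP; exists alpha.
apply/eqP => A0.
by case: bA => _ _; rewrite A0 big_seq_fset0 => /eqP; rewrite eq_sym oner_eq0.
Qed.

Lemma stellar_subdivision_sub T K : stellar_subdivision T K -> subdivision T K.
Proof.
case/stellar_subdivisionP=> A [a [alpha [AK bA a0 E]]]; apply/subdivisionP.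
split=> [S|B x]; rewrite E; first exact: (stellar_hull AK bA a0).
exact: (stellar_cover AK bA a0).
Qed.

Inductive stellar_chain K : complex R N -> Prop :=
| chain_refl : stellar_chain K K
| chain_step T T' : stellar_chain K T -> stellar_subdivision T' T -> stellar_chain K T'.

Lemma stellar_chain_trans K T L : stellar_chain K T -> stellar_chain T L -> stellar_chain K L.
Proof. by move=> KT; elim=> // T1 T2 _ K1 S; apply: chain_step K1 S. Qed.

Lemma stellar_chain_sub K T : stellar_chain K T -> subdivision T K.
Proof.
elim=> [|T1 T2 _ IH S]; first exact: subdivision_refl.
exact: subdivision_trans (stellar_subdivision_sub S) IH.
Qed.

Definition one_sided (l : 'rV[R]_N -> R) (K : complex R N) : Prop :=
  forall A, A \in simplexes K ->
    (forall v, v \in A -> 0 <= l v) \/ (forall v, v \in A -> l v <= 0).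

Lemma affine_hull_ge0 (l : 'rV[R]_N -> R) A x : affine l -> (forall v, v \in A -> 0 <= l v) ->
  hull A x -> 0 <= l x.
Proof.
move=> aff l0 /hullP[c bA]; rewrite (affine_bary aff bA) big_seq sumr_ge0 // => v vA.
by rewrite mulr_ge0 ?l0 ?(bary_ge0 _ bA).
Qed.

Lemma affineN (l : 'rV[R]_N -> R) : affine l -> affine (fun x : 'rV[R]_N => - l x).
Proof.
move=> aff; have -> : (fun x => - l x) = (fun x => -1 * l x).
  by apply/funext => x; rewrite mulN1r.
exact: affineZ.
Qed.

Lemma affine_hull_le0 (l : 'rV[R]_N -> R) A x : affine l -> (forall v, v \in A -> l v <= 0) ->
  hull A x -> l x <= 0.
Proof.
move=> aff l0 Ax; rewrite -oppr_ge0.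
by apply: (affine_hull_ge0 (affineN aff)) Ax => v vA; rewrite oppr_ge0 l0.
Qed.

Lemma one_sided_sub l T K : affine l -> subdivision T K -> one_sided l K -> one_sided l T.
Proof.
move=> aff /subdivisionP[TK _] lK S /TK[B /lK[l0|l0] SB]; [left|right] => v /SB.
  exact: affine_hull_ge0.
exact: affine_hull_le0.
Qed.

Definition crossing (l : 'rV[R]_N -> R) (K : complex R N) :=
  [fset A in simplexes K | [exists u : A, exists v : A,
     (A == [fset val u; val v]) && (l (val u) < 0) && (0 < l (val v))]].

Lemma crossingP l K A : A \in crossing l K <->
  exists u v, [/\ A = [fset u; v], A \in simplexes K, l u < 0 & 0 < l v].
Proof.
rewrite !inE; split.
  case/andP=> AK /existsP[u /existsP[v /andP[/andP[/eqP E lu] lv]]].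
  by exists (val u), (val v).
move=> [u [v [E AK lu lv]]]; rewrite AK /=.
have uA : u \in A by rewrite E !inE eqxx.
have vA : v \in A by rewrite E !inE eqxx orbT.
apply/existsP; exists [` uA]%fset; apply/existsP; exists [` vA]%fset.
by rewrite -E eqxx lu lv.
Qed.

(** A simplex with vertices strictly on both sides has an edge that crosses. Starring this edge at
    its zero of [l] removes it, and no crossing edge appears, since every new edge ends at [a],
    where [l] vanishes. *)
Lemma cut_step l K : affine l -> ~ one_sided l K ->
  exists2 T, stellar_subdivision T K & crossing l T `<` crossing l K.
Proof.
move=> aff /existsNP[A /not_implyP[AK /not_orP[/existsNP[u]]]].
move=> /not_implyP[uA /negP] lu /existsNP[v /not_implyP[vA /negP]].
rewrite -!ltNge in lu * => lv; pose E := [fset u; v].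
have EK : E \in simplexes K.
  by apply: simplexes_face AK _; rewrite fsubUset !fsub1set uA vA.
have uv : u != v by apply: contraTneq lu => ->; rewrite -leNgt ltW.
have D0 : 0 < l v - l u by rewrite subr_gt0 (lt_trans lu).
(* These weights place [a] at the zero of [l] on the edge. *)
pose alpha w := if w == u then l v / (l v - l u)
  else if w == v then - l u / (l v - l u) else 0.
pose a := \sum_(w <- E) alpha w *: w.
have sumE (F : 'rV[R]_N -> R) : \sum_(w <- E) F w = F u + F v.
  by rewrite big_fsetU1 ?inE // big_seq_fset1.
have au : alpha u = l v / (l v - l u) by rewrite /alpha eqxx.
have av : alpha v = - l u / (l v - l u) by rewrite /alpha eq_sym (negbTE uv) eqxx.
have a0 w : w \in E -> 0 < alpha w.
  by rewrite !inE => /orP[/eqP ->|/eqP ->]; rewrite ?au ?av divr_gt0 // oppr_gt0.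
have bE : bary E alpha a.
  split=> [w /a0/ltW//|w||//].
    by rewrite !inE negb_or /alpha => /andP[/negbTE -> /negbTE ->].
  by rewrite sumE au av -mulrDl divff // gt_eqF.
have la : l a = 0.
  rewrite (affine_bary aff bE) sumE au av; field.
  by rewrite gt_eqF.
exists (stellar_complex EK bE a0); first exact: stellar_complexP.
have Ecr : E \in crossing l K by apply/crossingP; exists u, v.
have fr := stellar_fresh EK bE a0.
apply: (@fsub_proper_trans _ (crossing l K `\ E)); last exact: fproperD1.
apply/fsubsetP => B /crossingP[u' [v' [EB]]].
move=> /(stellarP _ (@complex_face_closed _ _ K) fr)[[aB BK nE]|[aB BE nE]] lu' lv'.
  rewrite in_fsetD1; apply/andP; split; last by apply/crossingP; exists u', v'.
  by apply: contraNneq nE => ->; apply: fsubset_refl.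
move: aB; rewrite EB !inE => /orP[/eqP E'|/eqP E'].
  by move: lu'; rewrite -E' la ltxx.
by move: lv'; rewrite -E' la ltxx.
Qed.

Lemma cut l K : affine l -> exists2 T, stellar_chain K T & one_sided l T.
Proof.
move=> aff; move En : #|` crossing l K| => n.
elim/ltn_ind: n K En => n IH K En.
have [lK|/cut_step[//|T TK]] := pselect (one_sided l K).
  by exists K => //; constructor.
move=> /fproper_ltn_card; rewrite En => /IH/(_ T erefl)[T' chT lT'].
exists T' => //; apply: stellar_chain_trans chT.
exact: chain_step (chain_refl _) TK.
Qed.

Lemma cut_list (ls : seq ('rV[R]_N -> R)) K : (forall l, l \in ls -> affine l) ->
  exists2 T, stellar_chain K T & forall l, l \in ls -> one_sided l T.
Proof.
elim: ls K => [|l ls IH] K aff; first by exists K => //; constructor.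
have affl : affine l by apply: aff; rewrite mem_head.
have [T KT lT] := cut K affl.
have [|T' TT' lsT'] := IH T; first by move=> l' l'ls; apply: aff; rewrite inE l'ls orbT.
exists T'; first exact: stellar_chain_trans KT TT'.
move=> l'; rewrite inE => /predU1P[->|/lsT'//].
exact: one_sided_sub (stellar_chain_sub TT') lT.
Qed.

End Subdivisions.

(** * Simplicial isomorphisms *)

Section Isomorphisms.

(** Both maps are total, but are inverse to each other only on vertices that occur in the
    complexes. *)
Definition iso_pair (V W : choiceType) (f : V -> W) (g : W -> V)
    (K : {fset {fset V}}) (L : {fset {fset W}}) : Prop :=
  [/\ forall A v, A \in K -> v \in A -> g (f v) = v,
      forall B w, B \in L -> w \in B -> f (g w) = w,
      forall A, A \in K -> f @` A \in L & forall B, B \in L -> g @` B \in K].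

Variables (V W : choiceType) (K : {fset {fset V}}) (L : {fset {fset W}}).
Hypotheses (clK : face_closed K) (clL : face_closed L).

Lemma simplicial_isomorphicI (f : V -> W) :
  (forall A B u v, A \in K -> B \in K -> u \in A -> v \in B -> f u = f v -> u = v) ->
  (forall A, A \in K -> f @` A \in L) ->
  (forall B, B \in L -> exists2 A, A \in K & B = f @` A) ->
  simplicial_isomorphic K L.
Proof.
move=> inj img surj; have vK (v : V) : v \in [fset v] by rewrite inE.
exists f; split; split=> [x /= xK|x y|B /=].
- by rewrite /vertices /= -imfset_fset1; apply: img.
- by rewrite !inE /vertices /= => xK yK; apply: (inj _ _ _ _ xK yK).
- move=> BL; have [A AK EA] := surj _ BL.
  have : B \in f @` A by rewrite -EA inE.
  case/imfsetP=> v /= vA ->; exists v => //.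
  by apply: clK AK _; rewrite fsub1set.
- exact: img.
- rewrite !inE /= => xK yK E; apply/fsetP => v; apply/idP/idP => vx.
    have : f v \in f @` y by rewrite -E in_imfset.
    by case/imfsetP=> u /= uy /(inj _ _ _ _ xK yK vx uy) ->.
  have : f v \in f @` x by rewrite E in_imfset.
  by case/imfsetP=> u /= uy /(inj _ _ _ _ yK xK vx uy) ->.
- by move=> /surj[A AK ->]; exists A.
Qed.

(** [v0] is the value of the inverse off the vertices of [L]. *)
Lemma simplicial_isomorphicE (v0 : V) : simplicial_isomorphic K L ->
  exists f g, @iso_pair V W f g K L.
Proof.
case=> f [[fun1 inj1 surj1] [fun2 inj2 surj2]]; exists f.
have /choice[g gP] w : exists v, [fset w] \in L -> [fset v] \in K /\ f v = w.
  have [/surj1[v vK <-]|] := boolP ([fset w] \in L); first by exists v.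
  by exists v0.
have fset1_K A v : A \in K -> v \in A -> [fset v] \in K.
  by move=> AK vA; apply: clK AK _; rewrite fsub1set.
have gK A v : A \in K -> v \in A -> g (f v) = v.
  move=> AK vA; have vK := fset1_K _ _ AK vA.
  have [gv fg] := gP (f v) (fun1 v vK).
  by apply: inj1 fg; rewrite inE.
exists g; split=> // [B w BL wB|B BL].
- have wL : [fset w] \in L by apply: clL BL _; rewrite fsub1set.
  by have [] := gP w wL.
- have [A AK <-] := surj2 _ BL; rewrite -imfset_comp.
  suff -> : (g \o f) @` A = A by [].
  rewrite -[RHS]imfset_id; apply: eq_in_imfset => // v vA /=; exact: gK vA.
Qed.

End Isomorphisms.

Lemma iso_pair_sym (V W : choiceType) (f : V -> W) g K L :
  iso_pair f g K L -> iso_pair g f L K.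
Proof. by case. Qed.

Lemma iso_pair_simplicial (V W : choiceType) (f : V -> W) g K L : face_closed K ->
  iso_pair f g K L -> simplicial_isomorphic K L.
Proof.
move=> clK [gK fK img img']; apply: (@simplicial_isomorphicI _ _ _ _ clK f) => //.
  by move=> A B u v AK BK uA vB E; rewrite -(gK A u) // E (gK B v).
move=> B BL; exists (g @` B); first exact: img'.
rewrite -imfset_comp -[LHS]imfset_id; apply: eq_in_imfset => // v vB /=.
by rewrite (fK B).
Qed.

Lemma simplicial_isomorphic_sym (V W : choiceType) (v0 : V) K L :
  face_closed K -> face_closed L ->
  @simplicial_isomorphic V W K L -> simplicial_isomorphic L K.
Proof.
move=> clK clL /(simplicial_isomorphicE clK clL v0)[f [g /iso_pair_sym]].
exact: iso_pair_simplicial.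
Qed.

Lemma simplicial_isomorphic_trans (V W X : choiceType) K L M :
  face_closed K ->
  @simplicial_isomorphic V W K L -> @simplicial_isomorphic W X L M ->
  simplicial_isomorphic K M.
Proof.
move=> clK [f [[f1 i1 s1] [f2 i2 s2]]] [g [[f1' i1' s1'] [f2' i2' s2']]].
have fset1_K A v : A \in K -> v \in A -> [fset v] \in K.
  by move=> AK vA; apply: clK AK _; rewrite fsub1set.
apply: (@simplicial_isomorphicI _ _ _ _ clK (g \o f)).
- move=> A B u v AK BK uA vB /= E.
  have uK := fset1_K _ _ AK uA; have vK := fset1_K _ _ BK vB.
  apply: i1; rewrite ?inE //; apply: i1' => //; rewrite inE; exact: f1.
- by move=> A AK; rewrite imfset_comp; apply/f2'/f2.
- move=> B /s2'[C /s2[A AK <-] <-]; exists A => //.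
  by rewrite -imfset_comp.
Qed.

(** * Carrying a subdivision along an isomorphism *)

Section Transport.
Variables (R : realType).

Section Weights.
Variables (N : nat) (K : complex R N).
Local Notation P := 'rV[R]_N.

Lemma weight_ex : exists wt : P -> P -> R,
  forall A x, A \in simplexes K -> hull A x -> bary A (wt x) x.
Proof.
suff /choice[wt wtP] x : exists c, forall A, A \in simplexes K -> hull A x -> bary A c x.
  by exists wt => A x; apply: wtP.
have [[A AK /hullP[c bA]]|no] := pselect (polyhedron K x).
  by exists c => B BK /hullP[d bB]; rewrite (bary_eq AK BK bA bB).
by exists (fun=> 0) => A AK Ax; case: no; exists A.
Qed.

Definition weight : P -> P -> R := projT1 (cid weight_ex).

Lemma weightP A x : A \in simplexes K -> hull A x -> bary A (weight x) x.
Proof. by rewrite /weight; case: cid => /= wt; apply. Qed.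

Lemma weightE A c x : A \in simplexes K -> bary A c x -> weight x = c.
Proof.
move=> AK bA; apply: (bary_eq AK AK (weightP AK _) bA).
by apply/hullP; exists c.
Qed.

(** The piecewise linear extension of a vertex map. The sum may run over all vertices because the
    weights vanish off any simplex that contains [x]. *)
Definition pl_map M (f : P -> 'rV[R]_M) (x : P) : 'rV[R]_M :=
  \sum_(v <- \bigcup_(A <- simplexes K) A) weight x v *: f v.

Lemma pl_mapE M (f : P -> 'rV[R]_M) A x : A \in simplexes K -> hull A x ->
  pl_map f x = \sum_(v <- A) weight x v *: f v.
Proof.
move=> AK Ax; apply/esym/big_fset_incl; first exact: (bigfcup_sup (P := xpredT)).
by move=> v _ /(bary_out (weightP AK Ax)) ->; rewrite scale0r.
Qed.

Lemma pl_map_affine M (f : P -> 'rV[R]_M) A S c x : A \in simplexes K ->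
  (forall v, v \in S -> hull A v) -> bary S c x ->
  pl_map f x = \sum_(v <- S) c v *: pl_map f v.
Proof.
move=> AK SA [c0 _ c1 xE].
have := @bary_join _ _ _ S A c weight id c0 c1 (fun v vS => weightP AK (SA v vS)).
rewrite -xE => bx.
have Ax : hull A x by apply/hullP; eexists; apply: bx.
rewrite (pl_mapE _ AK Ax) (weightE AK bx).
under eq_bigr => v _ do rewrite scaler_suml.
rewrite exchange_big /=; apply: eq_big_seq => v vS.
rewrite (pl_mapE _ AK (SA v vS)) scaler_sumr; apply: eq_bigr => u _.
by rewrite scalerA.
Qed.

End Weights.

Lemma pl_mapK N M (K : complex R N) (L : complex R M) f g A x :
  iso_pair f g K L -> A \in simplexes K -> hull A x ->
  hull (f @` A) (pl_map K f x) /\ pl_map L g (pl_map K f x) = x.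
Proof.
move=> [gK _ img _] AK Ax; have bx := weightP AK Ax.
have injA : {in A &, injective f}.
  by move=> u v uA vA E; rewrite -(gK A u) // E (gK A).
pose c w := if w \in f @` A then weight K x (g w) else 0.
have cf v : v \in A -> c (f v) = weight K x v.
  by move=> vA; rewrite /c in_imfset //= (gK A).
have bfx : bary (f @` A) c (pl_map K f x).
  have [_ _ c1 xE] := bx; split=> [w wA|w /negbTE wA||].
  - by rewrite /c wA (bary_ge0 _ bx).
  - by rewrite /c wA.
  - by rewrite big_imfset // -c1; apply: eq_big_seq => v /= vA; rewrite cf.
  - rewrite (pl_mapE _ AK Ax) big_imfset //.
    by apply: eq_big_seq => v /= vA; rewrite cf.
have hfx : hull (f @` A) (pl_map K f x) by apply/hullP; exists c.
split=> //; rewrite (pl_mapE _ (img A AK) hfx) (weightE (img A AK) bfx) big_imfset //.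
case: bx => _ _ _ xE; rewrite [RHS]xE; apply: eq_big_seq => v /= vA; by rewrite cf // (gK A).
Qed.

(** The complex sought is the image of [T] under the piecewise linear extension [F] of the
    isomorphism. As [F] is injective on the polyhedron and affine on each simplex of [K],
    coordinates over an image simplex pull back to coordinates in [T], where they are unique. *)
Lemma subdivision_transport N M (K T : complex R N) (L : complex R M) :
  simplicial_isomorphic K L -> subdivision T K ->
  exists T' : complex R M, subdivision T' L /\ simplicial_isomorphic T T'.
Proof.
move=> /(simplicial_isomorphicE (@complex_face_closed _ _ K)
  (@complex_face_closed _ _ L) 0)[f [g fg]] /subdivisionP[TK KT].
pose F := pl_map K f; have gf := iso_pair_sym fg.
have injF A B x y : A \in simplexes K -> B \in simplexes K -> hull A x -> hull B y ->
    F x = F y -> x = y.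
  move=> AK BK Ax By E.
  have [_ <-] := pl_mapK fg AK Ax; have [_ <-] := pl_mapK fg BK By.
  by rewrite -/F E.
have injT S S' u v : S \in simplexes T -> S' \in simplexes T -> u \in S -> v \in S' ->
    F u = F v -> u = v.
  move=> /TK[A AK SA] /TK[B BK SB] uS vS.
  exact: injF AK BK (SA u uS) (SB v vS).
pose T' := [fset F @` (S : {fset 'rV[R]_N}) | S in simplexes T].
have clT' : face_closed T'.
  move=> A B /imfsetP[S /= ST ->] sB; apply/imfsetP.
  exists [fset v in S | F v \in B] => /=.
    by apply: simplexes_face ST _; apply/fsubsetP => v; rewrite !inE => /andP[].
  apply/fsetP => w; apply/idP/imfsetP => [wB|[v /= + ->]]; last by rewrite !inE => /andP[].
  have /imfsetP[v /= vS wE] := fsubsetP sB w wB.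
  by exists v => //; rewrite !inE vS -wE.
have bary_pull S c y : S \in simplexes T -> bary (F @` S) c y ->
    exists x, [/\ F x = y, exists2 A, A \in simplexes K & hull A x &
      bary S (fun v => if v \in S then c (F v) else 0) x].
  move=> ST [c0 _ c1 yE]; have injS : {in S &, injective F}.
    by move=> u v uS vS; apply: (injT _ _ _ _ ST ST uS vS).
  pose d v := if v \in S then c (F v) else 0.
  have bS : bary S d (\sum_(v <- S) d v *: v).
    split=> // [v vS|v /negbTE|]; rewrite /d; first by rewrite vS c0 // in_imfset.
      by move=> ->.
    by rewrite -c1 big_imfset //; apply: eq_big_seq => v /= ->.
  have [A AK SA] := TK _ ST.
  exists (\sum_(v <- S) d v *: v); split=> //.
    rewrite /F (pl_map_affine f AK SA bS) yE big_imfset //.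
    by apply: eq_big_seq => v /= vS; rewrite /d vS.
  by exists A => //; apply: hull_hull SA _; apply/hullP; exists d.
have uniqT' A B c d y : A \in T' -> B \in T' -> bary A c y -> bary B d y -> c = d.
  move=> /imfsetP[S /= ST ->] /imfsetP[S' /= ST' ->] bc bd.
  have [x [xy [A' AK Ax] bS]] := bary_pull _ _ _ ST bc.
  have [x' [xy' [B' BK Bx] bS']] := bary_pull _ _ _ ST' bd.
  have E : x = x' by apply: injF AK BK Ax Bx _; rewrite xy.
  rewrite -E in bS'; have {}E := bary_eq ST ST' bS bS'.
  apply/funext => w; have [/imfsetP[v /= vS ->]|wS] := boolP (w \in F @` S).
    have := congr1 (fun h => h v) E; rewrite /= vS => ->.
    case: ifPn => // vS'; apply/esym/(bary_out bd).
    apply/imfsetP => -[u /= uS' /(injT _ _ _ _ ST ST' vS uS') vu].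
    by rewrite vu uS' in vS'.
  rewrite (bary_out bc wS); have [/imfsetP[v /= vS' wE]|wS'] := boolP (w \in F @` S');
    last by rewrite (bary_out bd).
  have := congr1 (fun h => h v) E; rewrite /= vS' wE => <-; case: ifP => // vS.
  by case/negP: wS; rewrite wE in_imfset.
exists (complex_of_bary clT' uniqT'); split; last first.
  apply: (@simplicial_isomorphicI _ _ _ _ (@complex_face_closed _ _ T) F) => //.
    by move=> A AT; apply/imfsetP; exists A.
  by move=> B /imfsetP[A /= AT ->]; exists A.
apply/subdivisionP; split=> [A /imfsetP[S /= ST ->]|B y BL By].
  have [B BK SB] := TK _ ST; exists (f @` B); first by case: fg => _ _ + _; apply.
  by move=> w /imfsetP[v /= vS ->]; have [] := pl_mapK fg BK (SB v vS).
have [hgy Fgy] := pl_mapK gf BL By.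
have gBK : g @` B \in simplexes K by case: fg => _ _ _; apply.
have [S ST Sx] := KT _ _ gBK hgy; exists (F @` S); first by apply/imfsetP; exists S.
have [A AK SA] := TK _ ST; have /hullP[d bS] := Sx.
rewrite -Fgy (pl_map_affine f AK SA bS); have [d0 _ d1 _] := bS.
by apply: hull_comb => // v vS; apply: hull_vertex; apply: in_imfset.
Qed.

End Transport.

(** * Common subdivisions by cutting *)

Section CommonCut.
Variables (R : realType) (N : nat).
Local Notation P := 'rV[R]_N.

Definition halfspaces (ls : seq (P -> R)) (A : {fset P}) : Prop :=
  [/\ forall l, l \in ls -> affine l, forall l v, l \in ls -> v \in A -> 0 <= l v &
      forall x, (forall l, l \in ls -> 0 <= l x) -> hull A x].

(** The equations of the affine span together with the barycentric coordinates. *)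
Lemma halfspaces_ex (A : {fset P}) : affinely_independent A ->
  exists ls, halfspaces ls A.
Proof.
move=> indA; have [ls [aff ls0 lsA]] := affine_span_equations A.
have [lam [afflam lamE]] := affine_coord indA.
exists (ls ++ [seq lam v | v <- A]); split=> [l|l v|x H].
- by rewrite mem_cat => /orP[/aff//|/mapP[v _ ->]].
- rewrite mem_cat => /orP[lls vA|/mapP[u _ ->] vA]; first by rewrite ls0.
  by rewrite lamE ?ler0n.
- have /hspanP[c c1 xE] : homog x \in hspan A.
    by apply: lsA => l lls; apply: H; rewrite mem_cat lls.
  exists c; split=> // v vA.
  suff -> : c v = lam v x by apply: H; rewrite mem_cat map_f ?orbT.
  rewrite xE afflam // (bigD1_seq v) ?fset_uniq //= lamE // eqxx mulr1.
  rewrite big_seq_cond big1 ?addr0 // => u /andP[uA /negbTE uv].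
  by rewrite lamE // uv mulr0.
Qed.

Lemma complex_halfspaces (K : complex R N) : exists hs,
  forall A, A \in simplexes K -> halfspaces (hs A) A.
Proof.
suff /choice[hs hsP] A : exists ls, A \in simplexes K -> halfspaces ls A by exists hs.
have [AK|_] := boolP (A \in simplexes K); last by exists [::].
by have [ls H] := halfspaces_ex (simplexes_independent AK); exists ls.
Qed.

(** A simplex [S] of the cut complex lies in any [B] of [L] that contains its barycenter: an
    inequality of [B] has one sign on [S] and is nonnegative at the barycenter, hence nonnegative at
    all vertices. *)
Lemma common_cut (K L : complex R N) hs :
  (forall B, B \in simplexes L -> halfspaces (hs B) B) ->
  polyhedron K = polyhedron L -> fset0 \in simplexes L ->
  exists T, [/\ stellar_chain K T, subdivision T L &
    forall B l, B \in simplexes L -> l \in hs B -> one_sided l T].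
Proof.
move=> hsP EKL L0; pose ls := flatten [seq hs B | B <- simplexes L].
have [l|T KT lsT] := @cut_list R N ls K.
  by move=> /flattenP[l' /mapP[B BL ->]]; case: (hsP B BL) => + _ _; apply.
have lT B l : B \in simplexes L -> l \in hs B -> one_sided l T.
  by move=> BL lB; apply: lsT; apply/flattenP; exists (hs B) => //; apply: map_f.
have [ET TK] := stellar_chain_sub KT.
exists T; split=> //; split; first by rewrite ET.
(* The empty simplex has no barycenter, yet some simplex of [L] must still be named for it. *)
move=> S ST; have [->|S0] := eqVneq S fset0.
  by exists fset0 => // x /hull_fset0.
have [c bS c0] := bary_center S0.
have : polyhedron T (center S) by exists S => //; apply/hullP; exists c.
rewrite ET EKL => -[B BL Bx]; exists B => // y; apply: hull_hull => v vS.
have [aff hs0 hsB] := hsP B BL; apply: hsB => l lB.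
have [/(_ v vS)//|l0] := lT B l BL lB S ST.
have lx : 0 <= l (center S) by apply: (affine_hull_ge0 (aff l lB) _ Bx) => u; apply: hs0.
move: lx; rewrite (affine_bary (aff l lB) bS) (big_fsetD1 v) //= => lx.
have : \sum_(u <- S `\ v) c u * l u <= 0.
  rewrite big_seq sumr_le0 // => u; rewrite !inE => /andP[_ uS].
  by rewrite mulr_ge0_le0 ?l0 // ltW ?c0.
move=> le0; have : 0 <= c v * l v.
  by apply: le_trans lx _; rewrite gerDl.
by rewrite pmulr_rge0 ?c0.
Qed.

End CommonCut.

(** * Stellar moves preserve piecewise linear homeomorphism *)

Section PLInvariance.
Variable R : realType.

Lemma complex_isomorphic_sym N M (K : complex R N) (L : complex R M) :
  simplicial_isomorphic K L -> simplicial_isomorphic L K.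
Proof.
exact: (simplicial_isomorphic_sym 0 (@complex_face_closed _ _ K) (@complex_face_closed _ _ L)).
Qed.

(** Containing [fset0] means not being the empty collection; [common_cut] asks for this at every
    weld along a sequence of moves. *)
Lemma stellar_move_nonempty N M (K : complex R N) (L : complex R M) :
  stellar_move K L -> fset0 \in simplexes K -> fset0 \in simplexes L.
Proof.
have sub N' (K' L' : complex R N') : stellar_subdivision L' K' ->
    fset0 \in simplexes K' /\ fset0 \in simplexes L'.
  case=> A [a [AK A0 _ E]]; split; first exact: simplexes_face AK (fsub0set _).
  have [v vA] := fset0Pn _ A0.
  rewrite E in_fsetU; apply/orP; right; apply/in_ball.
    exact: complex_face_closed.
  by exists fset0, fset0; rewrite fsub0set !fset0U fsubset0 AK A0.
case: N M K L / => [N' K L /sub[]|N' K L /sub[]|N' M' K L [f [_ [img _ _]]] K0] //.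
by have := img _ K0; rewrite /= imfset0.
Qed.

(** For a weld, [T] subdivides only the target. Cutting [T] along the source gives a common
    subdivision, which is then carried to the side of [Z]. *)
Lemma pl_move N M (K : complex R N) (L : complex R M) : stellar_move K L ->
  fset0 \in simplexes K -> forall O (Z : complex R O),
  pl_homeomorphic L Z -> pl_homeomorphic K Z.
Proof.
case: N M K L / => [N K K' sub|N K K' sub|N M K L iso] K0 O Z [T [Z' [TK ZZ' isoT]]].
- by exists T, Z'; split=> //; apply: subdivision_trans TK (stellar_subdivision_sub sub).
- have [hs hsP] := complex_halfspaces K'.
  have [|T' [TT' T'K' _]] := common_cut (K := T) hsP _ K0.
    by case: TK => -> _; case: (stellar_subdivision_sub sub) => ->.
  have [Z'' [sZ isoZ]] := subdivision_transport isoT (stellar_chain_sub TT').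
  by exists T', Z''; split=> //; apply: subdivision_trans sZ ZZ'.
- have [T' [sT' isoT']] 
    := subdivision_transport (complex_isomorphic_sym iso) TK.
  exists T', Z'; split=> //.
  apply: simplicial_isomorphic_trans isoT; first exact: complex_face_closed.
  exact: complex_isomorphic_sym.
Qed.

Lemma simplicial_isomorphic_refl (V : choiceType) (K : {fset {fset V}}) :
  face_closed K -> simplicial_isomorphic K K.
Proof.
move=> clK; apply: (@iso_pair_simplicial _ _ id id) => //; split=> // A AK;
  by rewrite imfset_id.
Qed.

Lemma pl_of_stellar N M (K : complex R N) (L : complex R M) :
  stellar_equivalent K L -> fset0 \in simplexes K -> pl_homeomorphic K L.
Proof.
elim=> [N' K' _|N1 N2 N3 K1 K2 K3 mv _ IH K0].
  exists K', K'; split; [exact: subdivision_refl|exact: subdivision_refl|].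
  exact/simplicial_isomorphic_refl/complex_face_closed.
by apply: (pl_move mv K0); apply/IH/(stellar_move_nonempty mv K0).
Qed.

Lemma stellar_equivalent_trans N M O (K : complex R N) (L : complex R M)
    (Z : complex R O) :
  stellar_equivalent K L -> stellar_equivalent L Z -> stellar_equivalent K Z.
Proof.
move=> KL; elim: KL Z => // N1 N2 N3 K1 K2 K3 mv _ IH Z' KZ.
by apply: stellar_step mv _; apply: IH.
Qed.

Lemma stellar_equivalent_move N M (K : complex R N) (L : complex R M) :
  stellar_move K L -> stellar_equivalent K L.
Proof. by move=> mv; apply: stellar_step mv _; apply: stellar_refl. Qed.

Lemma stellar_equivalent_sym N M (K : complex R N) (L : complex R M) :
  stellar_equivalent K L -> stellar_equivalent L K.
Proof.
elim=> [N' K'|N1 N2 N3 K1 K2 K3 mv _ IH]; first exact: stellar_refl.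
apply: stellar_equivalent_trans IH _; apply: stellar_equivalent_move.
case: N1 N2 K1 K2 / mv => [N' K' L' s|N' K' L' s|N' M' K' L' s].
- exact: move_weld.
- exact: move_subdivision.
- exact/move_isomorphism/complex_isomorphic_sym.
Qed.

Lemma stellar_chain_equivalent N (K T : complex R N) :
  stellar_chain K T -> stellar_equivalent K T.
Proof.
elim=> [|T1 T2 _ KT1 s]; first exact: stellar_refl.
apply: stellar_equivalent_trans KT1 _; apply: stellar_equivalent_move.
exact: move_subdivision.
Qed.

End PLInvariance.

(** * Regular subdivisions *)

Section Regularity.
Variables (R : realType) (N : nat).
Local Notation P := 'rV[R]_N.
Implicit Types (K T : complex R N) (S s F : {fset P}) (f : P -> R).

Lemma homog_hull S v : hull S v -> homog v \in hspan S.
Proof. by case=> c [_ c1 ->]; apply/hspanP; exists c. Qed.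

Lemma hspan_sub S s : (forall v, v \in S -> hull s v) -> (hspan S <= hspan s)%VS.
Proof.
by move=> sSs; apply/span_subvP => _ /mapP[v vS ->]; apply/homog_hull/sSs.
Qed.

Lemma dim_hspan S : affinely_independent S -> \dim (hspan S) = #|` S|.
Proof. by move=> /free_homog/eqP ->; rewrite size_map. Qed.

Lemma card_hull S s : affinely_independent S -> (forall v, v \in S -> hull s v) ->
  (#|` S| <= #|` s|)%N.
Proof.
move=> indS /hspan_sub/dimvS; rewrite dim_hspan // => /leq_trans; apply.
by apply: leq_trans (dim_span _) _; rewrite size_map.
Qed.

Lemma hspan_eq S s : affinely_independent S -> (forall v, v \in S -> hull s v) ->
  (#|` s| <= #|` S|)%N -> hspan S = hspan s.
Proof.
move=> indS sSs le; apply/eqP; rewrite eqEdim hspan_sub //= (dim_hspan indS).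
by apply: leq_trans (dim_span _) _; rewrite size_map.
Qed.

(** Faces are extreme: off [s] the coordinates of [x] in [K] vanish, and they are sums, with
    positive weights, of the nonnegative coordinates of the vertices of [S]. *)
Lemma hull_carrier T K S s c x : subdivision T K -> S \in simplexes T ->
  s \in simplexes K -> bary S c x -> (forall v, v \in S -> 0 < c v) ->
  hull s x -> forall v, v \in S -> hull s v.
Proof.
move=> /subdivisionP[TK _] ST sK bS c0 sx v vS.
have [r rK Sr] := TK S ST.
have [c0' _ c1 xE] := bS.
have := @bary_join _ _ _ S r c (weight K) id c0' c1 (fun v vS => weightP rK (Sr v vS)).
rewrite -xE => bx; have E := bary_eq rK sK bx (weightP sK sx).
apply/hullP; exists (weight K v); apply: (bary_restrict (weightP rK (Sr v vS))) => u us.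
have := congr1 (fun h => h u) E; rewrite /= (bary_out (weightP sK sx) us).
have ge0 w : w \in S -> 0 <= c w * weight K w u.
  by move=> wS; rewrite mulr_ge0 ?c0' ?(bary_ge0 _ (weightP rK (Sr w wS))).
rewrite (big_fsetD1 v) //= => /eqP; rewrite paddr_eq0 ?ge0 //; last first.
  by rewrite big_seq sumr_ge0 // => w; rewrite !inE => /andP[_ /ge0].
by rewrite mulf_eq0 (gt_eqF (c0 v vS)) => /andP[/eqP].
Qed.

(* f is strictly convex across the faces of T inside each simplex of K: T is
   there the lower hull of the graph of f. *)
Definition regular T K f : Prop :=
  forall s F, s \in simplexes K -> F \in simplexes T ->
    (forall v, v \in F -> hull s v) -> #|` F| = #|` s| ->
  exists phi, [/\ affine phi, forall v, v \in F -> phi v = f v &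
    forall w, [fset w] \in simplexes T -> hull s w -> w \notin F -> phi w < f w].

(** The only full-dimensional simplex inside [s] is [s] itself, and no vertex is left to test. *)
Lemma regular_refl T : regular T T (fun=> 0).
Proof.
move=> s F sT FT Fs cFs; exists (fun=> 0); split=> //; first exact: affine0.
have sub : F `<=` s.
  apply/fsubsetP => v vF; apply: vertex_hull sT _ (Fs v vF).
  by apply: simplexes_face FT _; rewrite fsub1set.
have -> : F = s by apply/eqP; rewrite eqEfcard sub cFs leqnn.
by move=> w wT ws /negP[]; apply: vertex_hull sT wT ws.
Qed.

Lemma fset1_simplex T S v : S \in simplexes T -> v \in S -> [fset v] \in simplexes T.
Proof. by move=> ST vS; apply: simplexes_face ST _; rewrite fsub1set. Qed.

Lemma regular_stellar T T' K f : subdivision T K -> stellar_subdivision T' T ->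
  regular T K f -> exists f', regular T' K f'.
Proof.
move=> subTK /stellar_subdivisionP[A [a [alpha [AT bA alpha0 ET']]]] regf.
have fresh := stellar_fresh AT bA alpha0.
have stP S : S \in simplexes T' <->
    [/\ a \notin S, S \in simplexes T & ~~ (A `<=` S)] \/
    [/\ a \in S, (S `\ a) `|` A \in simplexes T & ~~ (A `<=` S `\ a)].
  by rewrite ET'; apply: (stellarP S (@complex_face_closed _ _ T) fresh).
have [_ _ a1 aE] := bA.
pose fa := \sum_(v <- A) alpha v * f v.
pose f' e v := if v == a then fa - e else f v.
(* Bounding [w] by the finite set [W] lets [small_fset] find one [e] for all vertices. *)
pose W := \bigcup_(S <- simplexes T') S.
pose Q s F e := (forall v, v \in F -> hull s v) -> #|` F| = #|` s| ->
  exists phi, [/\ affine phi, forall v, v \in F -> phi v = f' e v &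
    forall w, w \in W -> [fset w] \in simplexes T' -> hull s w -> w \notin F ->
      phi w < f' e w].
suff : small (fun e => forall s, s \in simplexes K -> forall F, F \in simplexes T' -> Q s F e).
  case/small_exists=> e _ H; exists (f' e) => s F sK FT Fs cF.
  have [phi [aff phiF phiw]] := H s sK F FT Fs cF.
  exists phi; split=> // w wT; apply: phiw => //.
  by apply/bigfcupP; exists [fset w]; rewrite ?andbT ?inE.
have wT w : w != a -> [fset w] \in simplexes T' -> [fset w] \in simplexes T.
  by move=> wa /stP[[]//|[]]; rewrite inE eq_sym (negbTE wa).
apply: small_fset => s sK; apply: small_fset => F FT'.
have [Fs|nFs] := pselect (forall v, v \in F -> hull s v); last by apply: small_true => e _ /nFs.
have [cFs|ncFs] := eqVneq #|` F| #|` s|; last first.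
  by apply: small_true => e _ _ E; rewrite E eqxx in ncFs.
have As : hull s a -> forall v, v \in A -> hull s v.
  exact: hull_carrier subTK AT sK bA alpha0.
case: (stP F).1 => // [[aF FT nAF]|[aF FAT nAF]].
  have [phi [aff phiF phiw]] := regf s F sK FT Fs cFs.
  have [sa|nsa] := pselect (hull s a); last first.
    apply: small_true => e _ _ _; exists phi; split=> // [v vF|w _ wT' sw wF].
      rewrite phiF // /f'; case: eqP => // va; by rewrite va (negbTE aF) in vF.
    have wa : w != a by apply: contra_notN nsa => /eqP <-.
    by rewrite /f' (negbTE wa) phiw // wT.
  (* [A] has a vertex off [F], where [f] is strictly above [phi]; hence the interpolated value [fa]
     is strictly above [phi a], and stays so after a small descent. *)
  have lt : phi a < fa.
    have /fsubsetPn[u uA uF] := nAF.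
    rewrite (affine_bary aff bA) /fa [ltLHS](big_fsetD1 u) //= [ltRHS](big_fsetD1 u) //=.
    apply: ltr_leD.
      by rewrite ltr_pM2l ?alpha0 //; apply: phiw => //;
        [exact: fset1_simplex AT uA|exact: As].
    rewrite big_seq [leRHS]big_seq ler_sum // => v; rewrite !inE => /andP[_ vA].
    rewrite ler_pM2l ?alpha0 //; have [vF|vF] := boolP (v \in F); first by rewrite phiF.
    by apply/ltW/phiw => //; [exact: fset1_simplex AT vA|exact: As].
  apply: small_mono (small_ltD 0 (-1) lt) => e _ lte _ _; exists phi.
  split=> // [v vF|w _ wT' sw wF].
    rewrite phiF // /f'; case: eqP => // va; by rewrite va (negbTE aF) in vF.
  rewrite /f'; case: eqP => [->|/eqP wa]; last by rewrite phiw // wT.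
  by move: lte; rewrite mulr0 addr0 mulrN1.
(* Now [F] contains [a]. By a count of dimensions, [A] has a single vertex [u] off [D], and adding
   it to [D] gives a facet of [T] inside [s]. *)
have sa := Fs a aF; set D := F `\ a in FAT nAF.
have /fsubsetPn[u uA uD] := nAF.
have DAs v : v \in D `|` A -> hull s v.
  by rewrite !inE => /orP[/andP[_ /Fs]|/(As sa)].
have EDu : D `|` A = u |` D.
  apply/esym/eqP; rewrite eqEfcard; apply/andP; split.
    by rewrite fsubUset fsub1set !inE uA orbT fsubsetUl.
  apply: leq_trans (card_hull (simplexes_independent FAT) DAs) _.
  by rewrite -cFs cardfsU1 uD /D (cardfsD1 a F) aF.
have cDA : #|` D `|` A| = #|` s|.
  by rewrite EDu cardfsU1 uD -cFs /D (cardfsD1 a F) aF.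
have [phi [aff phiF phiw]] := regf s _ sK FAT DAs cDA.
have [lam [afflam lamE]] := affine_coord (simplexes_independent FAT).
have uF : u \notin D `|` A -> False by rewrite !inE uA orbT.
have lamu v : v \in D `|` A -> lam u v = (v == u)%:R.
  by move=> vF; rewrite lamE.
have AF v : v \in A -> v \in D `|` A by move=> vA; rewrite !inE vA orbT.
have lama : lam u a = alpha u.
  rewrite (affine_bary (afflam u) bA) (big_fsetD1 u) //= lamu ?AF // eqxx mulr1.
  rewrite big_seq big1 ?addr0 // => v; rewrite !inE => /andP[vu vA].
  by rewrite lamu ?AF // (negbTE vu) mulr0.
have phia : phi a = fa.
  rewrite (affine_bary aff bA); apply: eq_big_seq => v vA.
  by rewrite phiF // AF.
(* Tilting [phi] about [D] by a multiple of [lam u] lowers it by [e] at [a], because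
   [lam u a = alpha u]. At [u] it drops by [e / alpha u], which settles [w = u]; the other vertices
   stay above for small [e]. *)
suff : small (fun e => forall w, w \in W -> [fset w] \in simplexes T -> hull s w ->
    w \notin D `|` A -> phi w + e * - (lam u w / alpha u) < f w).
  apply: small_mono => e e0 H _ _; exists (fun x => phi x + (- (e / alpha u)) * lam u x).
  split=> [|v vF|w wW wT' sw wF]; first by apply/affineD/affineZ.
    rewrite /f'; case: eqP => [->|/eqP va].
      by rewrite phia lama mulNr divfK // gt_eqF ?alpha0.
    have vD : v \in D by rewrite !inE va.
    have vDA : v \in D `|` A by rewrite inE vD.
    have vu : v != u by apply: contraTneq vD => ->.
    by rewrite phiF // lamu // (negbTE vu) mulr0 addr0.
  have wa : w != a by apply: contraNneq wF => ->.
  have wD : w \notin D by rewrite !inE negb_and wF orbT.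
  rewrite /f' (negbTE wa); have [->|wu] := eqVneq w u.
    rewrite phiF ?AF // lamu ?AF // eqxx mulr1 gtrDl oppr_lt0.
    by rewrite divr_gt0 // alpha0.
  have wF' : w \notin D `|` A by rewrite EDu !inE negb_or wu; move: wD; rewrite !inE.
  have := H w wW (wT w wa wT') sw wF'.
  by rewrite mulNr mulrN mulrA mulrAC.
apply: small_fset => w _.
have [[wT' [sw wF]]|no] := pselect ([fset w] \in simplexes T /\ hull s w /\ w \notin D `|` A).
  have := small_ltD (- (lam u w / alpha u)) 0 (phiw w wT' sw wF).
  by apply: small_mono => e _ + _ _ _; rewrite mulr0 addr0.
by apply: small_true => e _ wT' sw wF; case: no.
Qed.

Lemma regular_chain K T : stellar_chain K T -> exists f, regular T K f.
Proof.
elim=> [|T1 T2 KT1 [f regf] s]; first by exists (fun=> 0); apply: regular_refl.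
exact: regular_stellar (stellar_chain_sub KT1) s regf.
Qed.

Lemma ltr_sum_strict (I : eqType) (r : seq I) (F G : I -> R) i :
  i \in r -> F i < G i -> (forall j, j \in r -> F j <= G j) ->
  \sum_(j <- r) F j < \sum_(j <- r) G j.
Proof.
move=> ir lti le; rewrite !(perm_big _ (perm_to_rem ir)) !big_cons /=.
apply: ltr_leD => //; rewrite big_seq [leRHS]big_seq ler_sum // => j jr.
by apply: le; apply: mem_rem jr.
Qed.

(* Adding a small multiple of g, convex inside the simplexes of K', to the
   functions |l| makes up for the bends across the walls l = 0 of K'. *)
Lemma regular_coarsen K K' T g hs : subdivision K' K -> subdivision T K' ->
  fset0 \in simplexes K' ->
  (forall B, B \in simplexes K' -> halfspaces (hs B) B) ->
  (forall B l, B \in simplexes K' -> l \in hs B -> one_sided l T) ->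
  regular T K' g -> exists f, regular T K f.
Proof.
move=> K'K TK' K'0 hsP hsT regg.
pose ls := flatten [seq hs B | B <- simplexes K'].
have lsP l : l \in ls -> affine l /\ one_sided l T.
  move=> /flattenP[l' /mapP[B BK' ->]] lB; split; last exact: hsT lB.
  by have [+ _ _] := hsP B BK'; apply.
pose f0 x := \sum_(l <- ls) `|l x|.
pose W := \bigcup_(S <- simplexes T) S.
pose Q s F e := (forall v, v \in F -> hull s v) -> #|` F| = #|` s| ->
  exists phi, [/\ affine phi, forall v, v \in F -> phi v = f0 v + e * g v &
    forall w, w \in W -> [fset w] \in simplexes T -> hull s w -> w \notin F ->
      phi w < f0 w + e * g w].
suff : small (fun e => forall s, s \in simplexes K -> forall F, F \in simplexes T -> Q s F e).
  case/small_exists=> e _ H; exists (fun v => f0 v + e * g v) => s F sK FT Fs cF.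
  have [phi [aff phiF phiw]] := H s sK F FT Fs cF.
  exists phi; split=> // w wT; apply: phiw => //.
  by apply/bigfcupP; exists [fset w]; rewrite ?andbT ?inE.
apply: small_fset => s sK; apply: small_fset => F FT.
have [Fs|nFs] := pselect (forall v, v \in F -> hull s v); last by apply: small_true => e _ /nFs.
have [cFs|ncFs] := eqVneq #|` F| #|` s|; last first.
  by apply: small_true => e _ _ E; rewrite E eqxx in ncFs.
have [s0|F0] := eqVneq F fset0.
  apply: small_true => e _ _ _; exists (fun=> 0); split; first exact: affine0.
    by rewrite s0.
  move=> w _ _ sw; have sE : s = fset0 by apply/eqP; rewrite -cardfs_eq0 -cFs s0 cardfs0.
  by case: (@hull_fset0 _ _ w); rewrite -sE.
have [c bF c0] := bary_center F0.
have Fx : hull F (center F) by apply/hullP; exists c.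
have [r' r'K' Fr'] := ((subdivisionP _ _).1 TK').1 F FT.
(* The carrier [s'] in [K'] of the barycenter of [F] contains [F] and lies in [s]. It is squeezed to
   the dimension of [s], so [regg] applies to [F] in [s']. *)
have [s' [d [s'K' _ bs' d0]]] := carrier r'K' (hull_hull Fr' Fx).
have Fs' : forall v, v \in F -> hull s' v.
  by apply: hull_carrier TK' FT s'K' bF c0 _; apply/hullP; exists d.
have s's : forall v, v \in s' -> hull s v.
  by apply: hull_carrier K'K s'K' sK bs' d0 _; apply: hull_hull Fs Fx.
have cFs' : #|` F| = #|` s'|.
  apply/eqP; rewrite eqn_leq (card_hull (simplexes_independent FT) Fs') cFs.
  exact: card_hull (simplexes_independent s'K') s's.
have [phi [aff phiF phiw]] := regg s' F s'K' FT Fs' cFs'.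
(* With the sign that [l] has on [F], [sg l * l] is an affine support of the absolute value: equal
   to it on [F] and at most it elsewhere. *)
pose sg (l : P -> R) : R := if `[< forall v, v \in F -> 0 <= l v >] then 1 else -1.
have sgF l v : l \in ls -> v \in F -> sg l * l v = `|l v|.
  move=> lls vF; rewrite /sg; case: asboolP => [/(_ v vF) l0|n].
    by rewrite mul1r ger0_norm.
  have [_ /(_ F FT)[/n//|/(_ v vF) l0]] := lsP l lls.
  by rewrite mulN1r ler0_norm.
have sgle l w : sg l * l w <= `|l w|.
  by rewrite /sg; case: ifP => _; rewrite ?mul1r ?mulN1r ?ler_norm // ler_normr lexx orbT.
pose psi x := \sum_(l <- ls) sg l * l x.
have affpsi : affine psi.
  have -> : psi = (fun x => \sum_(l <- ls) (if l \in ls then sg l * l x else 0)).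
    by apply/funext => x; apply: eq_big_seq => l ->.
  apply: affine_sum => l; case: (boolP (l \in ls)) => [/lsP[affl _]|_]; last exact: affine0.
  exact: affineZ.
suff : small (fun e => forall w, w \in W -> [fset w] \in simplexes T -> hull s w ->
    w \notin F -> psi w + e * phi w < f0 w + e * g w).
  apply: small_mono => e e0 H _ _; exists (fun x => psi x + e * phi x).
  split=> // [|v vF]; first by apply/affineD/affineZ.
  rewrite phiF //; congr (_ + _); apply: eq_big_seq => l lls; exact: sgF.
apply: small_fset => w _.
have [[wT [sw wF]]|no] := pselect ([fset w] \in simplexes T /\ hull s w /\ w \notin F); last first.
  by apply: small_true => e _ wT sw wF; case: no.
(* Inside [s'] the strictness comes from [g]. Outside, [w] is beyond some wall of [s'], where the
   support is strict, and a small [e] absorbs the contribution of [g]. *)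
have [s'w|ns'w] := pselect (hull s' w).
  apply: small_true => e e0 _ _ _; apply: ler_ltD.
    by rewrite ler_sum.
  by rewrite ltr_pM2l // phiw.
have [l ls' lw] : exists2 l, l \in hs s' & l w < 0.
  apply: contrapT => no; apply: ns'w; have [_ _ H] := hsP s' s'K'; apply: H => l lh.
  by rewrite leNgt; apply/negP => lw; apply: no; exists l.
have lls : l \in ls by apply/flattenP; exists (hs s') => //; apply: map_f.
have lF v : v \in F -> 0 <= l v.
  move=> vF; have [aff' pos _] := hsP s' s'K'.
  by apply: (affine_hull_ge0 (aff' l ls') _ (Fs' v vF)) => u us'; apply: pos.
have lt : psi w < f0 w.
  apply: (ltr_sum_strict lls) => [|l' _]; last exact: sgle.
  rewrite /sg; case: asboolP => [_|[]//].
  rewrite mul1r ltr0_norm //.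
  by apply: (lt_trans lw); rewrite oppr_gt0.
apply: small_mono (small_ltD (phi w) (g w) lt) => e _ + _ _ _; exact.
Qed.

End Regularity.

(** * Facets inside a simplex, their neighbours, and generic points *)

Section Shelling.
Variables (R : realType) (N : nat) (K T : complex R N).
Local Notation P := 'rV[R]_N.
Hypothesis TK : subdivision T K.
Implicit Types (S s r F G : {fset P}) (x y p : P).

Definition inside S r : Prop := forall v, v \in S -> hull r v.

Lemma homog_segm e x y : homog (segm e x y) = (1 - e) *: homog x + e *: homog y.
Proof.
have := @homog_sum R N bool [:: true; false]
  (fun b => if b then 1 - e else e) (fun b => if b then x else y).
by rewrite !big_cons !big_nil !addr0 subrK; apply.
Qed.

Lemma hull_avoid S x y : affinely_independent S -> ~ hull S x ->
  small (fun e => ~ hull S (segm e x y)).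
Proof.
move=> /halfspaces_ex[ls [aff ls0 lsS]] nSx.
have [l lls lx] : exists2 l, l \in ls & l x < 0.
  apply: contrapT => no; apply: nSx; apply: lsS => l lls.
  by rewrite leNgt; apply/negP => lx; apply: no; exists l.
have nlx : 0 < - l x by rewrite oppr_gt0.
apply: small_mono (small_gt0 (l x - l y) nlx) => e _ lt Sz.
have := affine_hull_ge0 (aff l lls) (fun v => ls0 l v lls) Sz.
by rewrite (affine_segm _ _ _ (aff l lls)); nra.
Qed.

Lemma inside_cover s x : s \in simplexes K -> hull s x ->
  exists2 S, S \in simplexes T & inside S s /\ hull S x.
Proof.
move=> sK sx; have [_ H] := (subdivisionP _ _).1 TK.
have [S0 S0T S0x] := H s x sK sx.
have [S [c [ST _ bS c0]]] := carrier S0T S0x.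
exists S => //; split; last by apply/hullP; exists c.
exact: hull_carrier TK ST sK bS c0 sx.
Qed.

Lemma extend s S c x y : s \in simplexes K -> S \in simplexes T ->
  bary S c x -> (forall v, v \in S -> 0 < c v) ->
  small (fun e => hull s (segm e x y)) ->
  exists S' e, [/\ S' \in simplexes T, inside S' s, S `<=` S', 0 < e &
    hull S' (segm e x y)].
Proof.
move=> sK ST bS c0 sm.
have : small (fun e => forall S', S' \in simplexes T -> ~ hull S' x -> ~ hull S' (segm e x y)).
  apply: small_fset => S' S'T; have [xS|nxS] := pselect (hull S' x).
    by apply: small_true => e _.
  by apply: small_mono (hull_avoid y (simplexes_independent S'T) nxS).
move=> /(small_and sm)/small_exists[e e0 [se He]].
have [S' S'T [S's S'z]] := inside_cover sK se.
exists S', e; split=> //; apply: (bary_support ST S'T bS c0).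
by apply: contrapT => /(He S' S'T).
Qed.

(** While [S] is too small, some vertex of [s] is off its affine span, and a step from the
    barycenter towards it reaches a strictly larger simplex. *)
Lemma facet_above s S : s \in simplexes K -> S \in simplexes T -> inside S s ->
  exists F, [/\ F \in simplexes T, inside F s, S `<=` F & #|` F| = #|` s|].
Proof.
move=> sK; have [n] := ubnP (#|` s| - #|` S|)%N.
elim: n S => // n IH S; rewrite ltnS => le ST Ss.
have [lt|ge] := ltnP #|` S| #|` s|; last first.
  exists S; split=> //; apply/eqP.
  by rewrite eqn_leq ge (card_hull (simplexes_independent ST) Ss).
suff [S' [S'T S's SS']] : exists S', [/\ S' \in simplexes T, inside S' s & S `<` S'].
  have [|F [FT Fs S'F cF]] := IH S' _ S'T S's.
    have := fproper_ltn_card SS'.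
    have := card_hull (simplexes_independent S'T) S's.
    lia.
  by exists F; split=> //; apply: fsubset_trans (fproper_sub SS') S'F.
have [S0|S0] := eqVneq S fset0.
  have : s != fset0 by rewrite -cardfs_gt0 (leq_ltn_trans _ lt).
  case/fset0Pn=> v vs.
  have [S' S'T [S's S'v]] := inside_cover sK (hull_vertex vs).
  exists S'; split=> //; rewrite S0 fproper0.
  by apply/eqP => E; rewrite E in S'v; apply: hull_fset0 S'v.
have [v vs vS] : exists2 v, v \in s & homog v \notin hspan S.
  apply: contrapT => no.
  have : (hspan s <= hspan S)%VS.
    apply/span_subvP => _ /mapP[v vs ->]; apply/negPn/negP => vS.
    by apply: no; exists v.
  move/dimvS; rewrite (dim_hspan (simplexes_independent sK)).
  by rewrite (dim_hspan (simplexes_independent ST)) leqNgt lt.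
have [c bS c0] := bary_center S0.
have Sx : hull S (center S) by apply/hullP; exists c.
have [|S' [e [S'T S's SS' e0 S'z]]] := @extend s S c (center S) v sK ST bS c0.
  apply: small_mono (small_le ltr01) => e e0 e1.
  apply: hull_segm => //; [exact: ltW|exact: hull_hull Ss Sx|exact: hull_vertex].
exists S'; split=> //; rewrite fproperEneq SS' andbT.
apply: contraNneq vS => E; rewrite -E in S'z.
have := homog_hull S'z; rewrite homog_segm.
rewrite rpredDl; last exact/memvZ/homog_hull.
by rewrite rpredZeq (gt_eqF e0).
Qed.

Definition on_boundary s S : Prop :=
  exists r, [/\ r \in simplexes K, r `<` s & inside S r].

(** The barycenter [x] of the face opposite to [v] is interior to [s]: a vanishing coordinate would
    put the whole face on the boundary, by [hull_carrier]. Hence a short step beyond [x], away from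
    [v], leaves [F] but not [s]. *)
Lemma neighbour s F v : s \in simplexes K -> F \in simplexes T -> inside F s ->
  #|` F| = #|` s| -> v \in F -> ~ on_boundary s (F `\ v) ->
  exists F', [/\ F' \in simplexes T, inside F' s, #|` F'| = #|` s|, F `\ v `<=` F' &
    v \notin F'].
Proof.
move=> sK FT Fs cF vF nbd; set D := F `\ v.
have DF : D `<=` F by apply: fsubsetDl.
have DT : D \in simplexes T by apply: simplexes_face FT DF.
have cD : #|` s| = #|` D|.+1 by rewrite -cF (cardfsD1 v F) vF.
have D0 : D != fset0.
  apply/eqP => D0; apply: nbd; exists fset0; split.
  - exact: simplexes_face sK (fsub0set _).
  - by rewrite fproper0 -cardfs_gt0 cD.
  - by rewrite -/D D0.
have [c bD c0] := bary_center D0; set x := center D in bD.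
have Dx : hull D x by apply/hullP; exists c.
have Ds : inside D s by move=> u uD; apply/Fs/(fsubsetP DF).
have sx := hull_hull Ds Dx.
have bx := weightP sK sx; have bv := weightP sK (Fs v vF).
set wx := weight K x in bx; set wv := weight K v in bv.
have wx0 u : u \in s -> 0 < wx u.
  move=> us; rewrite lt_neqAle (bary_ge0 _ bx) andbT eq_sym.
  apply/eqP => wu; apply: nbd; exists (s `\ u); split.
  - exact: simplexes_face sK (fsubsetDl _ _).
  - exact: fproperD1.
  - apply: hull_carrier TK DT (simplexes_face sK (fsubsetDl _ _)) bD c0 _.
    apply/hullP; exists wx; apply: (bary_restrict bx) => w.
    by rewrite !inE negb_and negbK => /orP[/eqP ->//|ws]; rewrite (bary_out bx).
(* The reflection of [v] in [x], where [lam v] takes the value -1. *)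
pose y := 2 *: x - v.
have segmE e : segm e x y = \sum_(u <- s) (wx u + e * (wx u - wv u)) *: u.
  under eq_bigr => u _ do rewrite mulrBr scalerDl scalerBl -!scalerA.
  rewrite big_split sumrB -!scaler_sumr /=.
  case: bx bv => _ _ _ <- [_ _ _ <-]; rewrite /segm /y.
  by rewrite !scalerBl scalerBr scale1r !scalerA mulr2n mulrDr mulr1 scalerDl -!addrA;
    congr (_ + _); rewrite !addrA addNr add0r.
have [|S [e [ST Ss DS e0 Sz]]] := @extend s D c x y sK DT bD c0.
  have : small (fun e => forall u, u \in s -> 0 < wx u + e * (wx u - wv u)).
    by apply: small_fset => u us; apply/small_gt0/wx0.
  apply: small_mono => e e0 H; rewrite segmE; eexists; split; last by [].
    by move=> u us; apply/ltW/H.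
  rewrite big_split /= -mulr_sumr sumrB.
  by case: bx bv => _ _ -> _ [_ _ -> _]; rewrite subrr mulr0 addr0.
have [lam [afflam lamE]] := affine_coord (simplexes_independent FT).
have lamx : lam v x = 0.
  rewrite (affine_bary (afflam v) bD) big_seq big1 // => u uD.
  rewrite lamE ?(fsubsetP DF) //; move: uD; rewrite !inE => /andP[/negbTE -> _].
  by rewrite mulr0.
have lamy : lam v y = -1.
  have -> : y = segm (-1) x v by rewrite /segm /y scaleN1r opprK.
  by rewrite (affine_segm _ _ _ (afflam v)) lamx lamE // eqxx mulr0 add0r mulr1.
have nFz : ~ hull F (segm e x y).
  move=> Fz; have : 0 <= lam v (segm e x y).
    by apply: affine_hull_ge0 (afflam v) _ Fz => u uF; rewrite lamE ?ler0n.
  by rewrite (affine_segm _ _ _ (afflam v)) lamx lamy mulr0 add0r mulrN1 oppr_ge0 leNgt e0.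
have cS := card_hull (simplexes_independent ST) Ss.
have vS : v \notin S.
  apply/negP => vS; apply: nFz; suff -> : F = S by [].
  apply/eqP; rewrite eqEfcard cF cS andbT; apply/fsubsetP => u uF.
  have [->//|uv] := eqVneq u v.
  by apply: (fsubsetP DS); rewrite !inE uv.
exists S; split=> //; apply/eqP; rewrite eqn_leq cS cD /=.
apply: fproper_ltn_card; rewrite fproperEneq DS andbT.
by apply/eqP => E; apply: nFz; apply: hull_sub DF _; rewrite E.
Qed.

(** Each function is nonzero somewhere on [s]. A small move of [p] towards such a point makes it
    nonzero at [p] and keeps what was already achieved. *)
Lemma generic_point s (phis : seq (P -> R)) : s \in simplexes K -> s != fset0 ->
  (forall phi, phi \in phis -> affine phi /\ exists2 y, hull s y & phi y != 0) ->
  exists p c, [/\ bary s c p, forall v, v \in s -> 0 < c v &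
    forall phi, phi \in phis -> phi p != 0].
Proof.
move=> sK s0; elim: phis => [|phi phis IH] H.
  by have [c bc c0] := bary_center s0; exists (center s), c.
have [|p [c [bc c0 pp]]] := IH; first by move=> psi ps; apply: H; rewrite inE ps orbT.
have [affphi [y /hullP[d bd] phiy]] := H phi (mem_head _ _).
have : small (fun e => forall psi, psi \in phi :: phis -> (1 - e) * psi p + e * psi y != 0).
  apply: small_all => psi; rewrite inE => /predU1P[->|/pp psip]; apply: small_neq0.
    by rewrite phiy orbT.
  by rewrite psip.
have half : 0 < 2^-1 :> R by rewrite invr_gt0.
move=> /(small_and (small_le half))/small_exists[e e0 [e1 He]].
have e1' : 0 < 1 - e by rewrite subr_gt0 (le_lt_trans e1) // invf_lt1 ?ltr1n.
exists (segm e p y), (fun v => (1 - e) * c v + e * d v); split=> [|v vs|psi ps].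
- have [_ outc c1 pE] := bc; have [_ outd d1 yE] := bd; split=> [v _|v vs||].
  + by rewrite addr_ge0 // mulr_ge0 ?(bary_ge0 _ bc) ?(bary_ge0 _ bd) // ltW.
  + by rewrite outc // outd // !mulr0 addr0.
  + by rewrite big_split /= -!mulr_sumr c1 d1 !mulr1 subrK.
  + rewrite /segm {1}pE {1}yE !scaler_sumr -big_split; apply: eq_bigr => v _ /=.
    by rewrite !scalerA scalerDl.
- by rewrite ltr_wpDr ?mulr_ge0 ?(bary_ge0 _ bd) ?mulr_gt0 ?c0 // ltW.
- by rewrite affine_segm ?He //; case: (H psi ps).
Qed.

End Shelling.

(** * Regular subdivisions of a simplex are shellable *)

Section RegularShelling.
Variables (R : realType) (N : nat) (K T : complex R N).
Local Notation P := 'rV[R]_N.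
Hypothesis TK : subdivision T K.
Implicit Types (S s F G A B : {fset P}).

(** The last clause is what a flip needs: [F] meets the earlier facets exactly in the join of [A]
    with the boundary of [B], and the later facets together with the boundary of [s] in the join of
    [B] with the boundary of [A]. *)
Definition shelling s (Fs : seq {fset P}) : Prop :=
  [/\ forall F, F \in Fs -> F \in simplexes T /\ inside F s,
      forall S, S \in simplexes T -> inside S s -> exists2 F, F \in Fs & S `<=` F &
      forall pre F post, Fs = pre ++ F :: post -> exists A B,
        [/\ A `|` B = F, fdisjoint A B,
            forall G, G `<=` F -> (exists2 F', F' \in pre & G `<=` F') <-> ~~ (B `<=` G) &
            forall G, G `<=` F -> (exists2 F', F' \in post & G `<=` F') \/ on_boundary K s G
              <-> ~~ (A `<=` G)]].

(* The facets are met in the order in which a point sinking from height +oo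
   above a generic p leaves the lower hull of the graph of f. *)
Lemma regular_shelling f s : regular T K f -> s \in simplexes K -> s != fset0 ->
  exists Fs, shelling s Fs.
Proof.
move=> regf sK s0.
pose isF F := `[< inside F s >] && (#|` F| == #|` s|).
pose Fs0 := [seq F <- simplexes T | isF F].
have Fs0P F : F \in Fs0 -> [/\ F \in simplexes T, inside F s & #|` F| = #|` s|].
  by rewrite mem_filter => /andP[/andP[/asboolP Fs /eqP cF] FT].
have memFs0 F : F \in simplexes T -> inside F s -> #|` F| = #|` s| -> F \in Fs0.
  by move=> FT Fs cF; rewrite mem_filter FT andbT; apply/andP; split; [apply/asboolP|apply/eqP].
have /choice[lam lamP] F : exists lam : P -> P -> R, F \in Fs0 -> (forall v, affine (lam v)) /\
    (forall u v, u \in F -> lam v u = (u == v)%:R).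
  have [/Fs0P[FT _ _]|_] := boolP (F \in Fs0); last by exists (fun _ _ => 0).
  by have [lam H] := affine_coord (simplexes_independent FT); exists lam.
have /choice[phi phiP] F : exists phi : P -> R, F \in Fs0 -> [/\ affine phi,
    forall v, v \in F -> phi v = f v &
    forall w, [fset w] \in simplexes T -> hull s w -> w \notin F -> phi w < f w].
  have [/Fs0P[FT Fs cF]|_] := boolP (F \in Fs0); last by exists (fun=> 0).
  by have [phi H] := regf s F sK FT Fs cF; exists phi.
have [mu [affmu muE]] := affine_coord (simplexes_independent sK).
(* Genericity keeps [p] off every hyperplane of [s] spanned by a codimension-one face of a facet. *)
have [|p [c [bc c0 lamp]]] := @generic_point R N K s
    (flatten [seq [seq lam F v | v <- enum_fset F] | F <- Fs0]) sK s0.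
  move=> l /flattenP[ls /mapP[F FFs0 ->] /mapP[v vF ->]].
  have [FT Fs cF] := Fs0P F FFs0; have [aff E] := lamP F FFs0.
  by split=> //; exists v; [exact: Fs|rewrite E // eqxx oner_neq0].
have lam0 F v : F \in Fs0 -> v \in F -> lam F v p != 0.
  move=> FFs0 vF; apply: lamp; apply/flattenP; exists [seq lam F v | v <- enum_fset F].
    by apply: map_f.
  by apply: map_f.
have sp : hull s p by apply/hullP; exists c.
have pE F : F \in Fs0 -> \sum_(v <- F) lam F v p = 1 /\ p = \sum_(v <- F) lam F v p *: v.
  move=> FFs0; have [FT Fs cF] := Fs0P F FFs0; have [aff E] := lamP F FFs0.
  have /hspanP[d d1 pE'] : homog p \in hspan F.
    rewrite (hspan_eq (simplexes_independent FT) Fs) ?cF //; exact: homog_hull.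
  suff lamd v : v \in F -> lam F v p = d v.
    split; first by rewrite -d1; apply: eq_big_seq => v /lamd.
    by rewrite {1}pE'; apply: eq_big_seq => v /lamd ->.
  move=> vF; rewrite {1}pE' aff // (big_fsetD1 v) //= E // eqxx mulr1.
  rewrite big_seq big1 ?addr0 // => u; rewrite !inE => /andP[/negbTE uv uF].
  by rewrite E // uv mulr0.
have affp F (l : P -> R) : F \in Fs0 -> affine l ->
    l p = \sum_(v <- F) lam F v p * l v.
  by move=> FFs0 affl; have [d1 E] := pE F FFs0; rewrite {1}E affl.
(* By [gap], the factors [f v - phi F' v] vanish on [F'] and are positive off it, so the signs of
   the coordinates of [p] in [F] alone decide which facet is higher over [p]. *)
have diff F F' : F \in Fs0 -> F' \in Fs0 ->
    phi F p - phi F' p = \sum_(v <- F) lam F v p * (f v - phi F' v).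
  move=> FF F'F; have [aff phiF _] := phiP F FF; have [aff' _ _] := phiP F' F'F.
  rewrite (affp F (phi F)) // (affp F (phi F')) // -sumrB; apply: eq_big_seq => v vF.
  by rewrite mulrBr phiF.
have gap F F' v : F \in Fs0 -> F' \in Fs0 -> v \in F ->
    if v \in F' then f v - phi F' v = 0 else 0 < f v - phi F' v.
  move=> FF F'F vF; have [_ phiF' phi'] := phiP F' F'F; have [FT Fs _] := Fs0P F FF.
  case: ifPn => vF'; first by rewrite phiF' // subrr.
  by rewrite subr_gt0 phi' // ?(fset1_simplex FT) //; apply: Fs.
have diffset F F' : F \in Fs0 -> F' \in Fs0 -> F != F' -> exists2 v, v \in F & v \notin F'.
  move=> /Fs0P[_ _ cF] /Fs0P[_ _ cF'] ne.
  have /fsubsetPn[v vF vF'] : ~~ (F `<=` F').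
    by apply: contra ne => sub; rewrite eqEfcard sub cF cF' leqnn.
  by exists v.
have ltp F F' : F \in Fs0 -> F' \in Fs0 -> F != F' ->
    (forall v, v \in F -> v \notin F' -> 0 < lam F v p) -> phi F' p < phi F p.
  move=> FF F'F ne pos; rewrite -subr_gt0 diff //.
  have [v vF vF'] := diffset F F' FF F'F ne.
  rewrite [ltLHS](_ : 0 = \sum_(w <- F) 0); last by rewrite big1.
  apply: (ltr_sum_strict vF) => [|u uF].
    by have := gap F F' v FF F'F vF; rewrite (negbTE vF') => gt0; rewrite mulr_gt0 // pos.
  have := gap F F' u FF F'F uF; case: ifPn => [_ ->|uF' gt0]; first by rewrite mulr0.
  by rewrite mulr_ge0 // ltW // pos.
have gtp F F' : F \in Fs0 -> F' \in Fs0 -> F != F' ->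
    (forall v, v \in F -> v \notin F' -> lam F v p < 0) -> phi F p < phi F' p.
  move=> FF F'F ne neg; rewrite -subr_lt0 diff //.
  have [v vF vF'] := diffset F F' FF F'F ne.
  rewrite [ltRHS](_ : 0 = \sum_(w <- F) 0); last by rewrite big1.
  apply: (ltr_sum_strict vF) => [|u uF].
    have := gap F F' v FF F'F vF; rewrite (negbTE vF') => gt0.
    by rewrite nmulr_rlt0 // neg.
  have := gap F F' u FF F'F uF; case: ifPn => [_ ->|uF' gt0]; first by rewrite mulr0.
  by rewrite mulr_le0_ge0 // ltW // neg.
(* A coordinate [mu u] of [s] that vanishes on [G] is nonnegative on [F] and positive at the
   interior point [p], which forces a positive coordinate of [p] at a vertex off [G]. *)
have bdP F G : F \in Fs0 -> G `<=` F -> on_boundary K s G ->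
    exists2 v, v \in F & v \notin G /\ 0 < lam F v p.
  move=> FF GF [r [rK rs Gr]]; have [FT Fs cF] := Fs0P F FF.
  have [u us ur] : exists2 u, u \in s & u \notin r.
    by move: rs; rewrite fproperE => /andP[_ /fsubsetPn].
  apply: contrapT => no.
  have mup : 0 < mu u p.
    rewrite (affine_bary (affmu u) bc) (big_fsetD1 u) //= muE // eqxx mulr1.
    rewrite big_seq big1 ?addr0 ?c0 // => w; rewrite !inE => /andP[/negbTE wu ws].
    by rewrite muE // wu mulr0.
  have := mup; rewrite (affp F _ FF (affmu u)) ltNge => /negP[].
  rewrite big_seq sumr_le0 // => v vF; have [vG|vG] := boolP (v \in G).
    have /hullP[d bd] := Gr v vG.
    rewrite (affine_bary (affmu u) bd) [X in _ * X]big_seq [X in _ * X]big1 ?mulr0 //.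
    move=> w wr; rewrite muE ?(fsubsetP (fproper_sub rs)) //.
    by case: eqP wr => [->|]; rewrite ?(negbTE ur) ?mulr0.
  apply: mulr_le0_ge0.
    by rewrite leNgt; apply/negP => gt0; apply: no; exists v.
  by apply: affine_hull_ge0 (affmu u) _ (Fs v vF) => w ws; rewrite muE ?ler0n.
have nbP F v : F \in Fs0 -> v \in F -> ~ on_boundary K s (F `\ v) ->
    exists F', [/\ F' \in Fs0, F' != F, F `\ v `<=` F' & v \notin F'].
  move=> FF vF nb; have [FT Fs cF] := Fs0P F FF.
  have [F' [F'T F's cF' sub vF']] := neighbour TK sK FT Fs cF vF nb.
  exists F'; split=> //; first exact: memFs0.
  by apply: contraNneq vF' => ->.
(* Decreasing height over [p]. Ties are harmless, since [ltp] and [gtp] give strict inequalities. *)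
pose leF F F' := phi F' p <= phi F p.
have leF_tot : total leF by move=> F F'; apply: le_total.
have leF_trans : transitive leF by move=> F F' F'' H1 H2; apply: le_trans H2 H1.
pose Fs := sort leF Fs0.
have memFs F : (F \in Fs) = (F \in Fs0) by rewrite mem_sort.
exists Fs; split=> [F|S ST Ss|pre F post EFs].
- by rewrite memFs => /Fs0P[].
- have [F [FT iF SF cF]] := facet_above TK sK ST Ss.
  by exists F => //; rewrite memFs memFs0.
have pre0 F' : F' \in pre -> F' \in Fs0.
  by rewrite -memFs EFs mem_cat => ->.
have post0 F' : F' \in post -> F' \in Fs0.
  by rewrite -memFs EFs mem_cat inE => ->; rewrite !orbT.
have FF : F \in Fs0 by rewrite -memFs EFs mem_cat mem_head orbT.
have : pairwise leF Fs by rewrite -sorted_pairwise // sort_sorted.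
rewrite EFs pairwise_cat pairwise_cons => /and3P[/allrelP le1 _ /andP[/allP le2 _]].
have : uniq Fs by rewrite sort_uniq filter_uniq // fset_uniq.
rewrite EFs cat_uniq /= negb_or => /and3P[_ /andP[Fpre _] /andP[Fpost _]].
have prepost F' : F' \in Fs0 -> F' != F -> (F' \in pre) || (F' \in post).
  by rewrite -memFs EFs mem_cat inE => + /negbTE E; rewrite E.
have preP F' : F' \in pre -> F' != F /\ phi F p <= phi F' p.
  move=> F'pre; split; first by apply: contraNneq Fpre => <-.
  by apply: (le1 F' F F'pre); rewrite mem_head.
have postP F' : F' \in post -> F' != F /\ phi F' p <= phi F p.
  move=> F'post; split; first by apply: contraNneq Fpost => <-.
  exact: le2.
(* Across the face opposite to [v] the neighbour is lower over [p] when [v] is in [A], hence later,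
   and higher when [v] is in [B], hence earlier. *)
exists [fset v in F | 0 < lam F v p], [fset v in F | lam F v p < 0]; split.
- apply/fsetP => v; rewrite !inE; case: (boolP (v \in F)) => //= vF.
  by have := lam0 F v FF vF; rewrite neq_lt orbC.
- apply/fdisjointP => v; rewrite !inE => /andP[-> /=] lt; by rewrite -leNgt ltW.
- move=> G GF; split.
    move=> [F' F'pre GF']; apply/negP => BG.
    have [ne le] := preP F' F'pre.
    have := ltp F F' FF (pre0 F' F'pre); rewrite eq_sym ne => /(_ isT); rewrite ltNge le => H.
    suff : false by []. apply: H => v vF vF'.
    have := lam0 F v FF vF; rewrite neq_lt => /orP[lt|//].
    by case/negP: vF'; apply/(fsubsetP GF')/(fsubsetP BG); rewrite !inE vF.
  case/fsubsetPn=> v; rewrite !inE => /andP[vF lt] vG.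
  have [|F' [F'F ne sub vF']] := nbP F v FF vF.
    move=> /(bdP F _ FF (fsubsetDl _ _))[u uF]; rewrite !inE negb_and negbK uF orbF.
    by case=> /eqP ->; rewrite ltNge ltW.
  exists F'; last first.
    by apply: fsubset_trans sub; rewrite fsubsetD1 GF.
  case/orP: (prepost F' F'F ne) => // /postP[_]; rewrite leNgt => /negP[].
  apply: gtp => // [|u uF uF']; first by rewrite eq_sym.
  have [->//|uv] := eqVneq u v; case/negP: uF'.
  by apply: (fsubsetP sub); rewrite !inE uv.
- move=> G GF; split.
    move=> H; apply/negP => AG; case: H => [[F' F'post GF']|bd].
      have [ne le] := postP F' F'post.
      have := gtp F F' FF (post0 F' F'post); rewrite eq_sym ne => /(_ isT); rewrite ltNge le => H.
      suff : false by []. apply: H => v vF vF'.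
      have := lam0 F v FF vF; rewrite neq_lt => /orP[//|lt].
      by case/negP: vF'; apply/(fsubsetP GF')/(fsubsetP AG); rewrite !inE vF.
    have [v vF [/negP vG lt]] := bdP F G FF GF bd; apply: vG.
    by apply: (fsubsetP AG); rewrite !inE vF.
  case/fsubsetPn=> v; rewrite !inE => /andP[vF lt] vG.
  have GFv : G `<=` F `\ v by rewrite fsubsetD1 GF.
  have [bd|nb] := pselect (on_boundary K s (F `\ v)).
    by right; case: bd => r [rK rs H]; exists r; split=> // w /(fsubsetP GFv)/H.
  left; have [F' [F'F ne sub vF']] := nbP F v FF vF nb.
  exists F'; last exact: fsubset_trans sub.
  case/orP: (prepost F' F'F ne) => // /preP[_]; rewrite leNgt => /negP[].
  apply: ltp => // [|u uF uF']; first by rewrite eq_sym.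
  have [->//|uv] := eqVneq u v; case/negP: uF'.
  by apply: (fsubsetP sub); rewrite !inE uv.
Qed.

End RegularShelling.

(** * Abstract complexes and their realizations *)

Section Realization.
Variable R : realType.

(** With one axis per vertex, the barycentric coordinates of a point are its entries, hence
    unique. *)
Lemma realizable (V : choiceType) (X : {fset {fset V}}) : face_closed X ->
  exists N (K : complex R N), simplicial_isomorphic X K.
Proof.
move=> clX; pose U := \bigcup_(A <- X) A.
pose n := size (enum_fset U).
pose f v : 'rV[R]_n := \row_j (index v (enum_fset U) == j)%:R.
have AU A v : A \in X -> v \in A -> v \in U.
  by move=> AX vA; apply/bigfcupP; exists A; rewrite ?AX.
have idxU v : v \in U -> (index v (enum_fset U) < n)%N by rewrite index_mem.
have fE u v (uU : u \in U) : f v 0 (Ordinal (idxU u uU)) = (v == u)%:R.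
  rewrite mxE /=; suff -> : (index v (enum_fset U) == index u (enum_fset U)) = (v == u) by [].
  apply/eqP/eqP => [E|->]; last by [].
  apply/esym; rewrite -[LHS](nth_index u uU) -E nth_index //.
  by rewrite -index_mem E idxU.
have injf u v : u \in U -> f u = f v -> u = v.
  move=> uU E; have := fE u v uU; rewrite -E fE eqxx.
  by case: (v =P u) => // _ /eqP; rewrite oner_eq0.
pose L := [fset f @` (A : {fset V}) | A in X].
have clL : face_closed L.
  move=> A B /imfsetP[S /= SX ->] sB; apply/imfsetP.
  exists [fset v in S | f v \in B] => /=.
    by apply: clX SX _; apply/fsubsetP => v; rewrite !inE => /andP[].
  apply/fsetP => w; apply/idP/imfsetP => [wB|[v /= + ->]]; last by rewrite !inE => /andP[].
  have /imfsetP[v /= vS wE] := fsubsetP sB w wB.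
  by exists v => //; rewrite !inE vS -wE.
have coordE A c x u (uU : u \in U) : A \in X -> bary (f @` A) c x ->
    x 0 (Ordinal (idxU u uU)) = c (f u).
  move=> AX [_ outc _ ->]; rewrite summxE big_imfset /=; last first.
    by move=> v w vA _; apply: injf; apply: AU vA.
  under eq_bigr => v _ do rewrite mxE fE.
  have [uA|uA] := boolP (u \in A).
    rewrite (big_fsetD1 u) //= eqxx mulr1 big_seq big1 ?addr0 // => v.
    by rewrite !inE => /andP[/negbTE -> _]; rewrite mulr0.
  rewrite big_seq big1; last first.
    by move=> v vA; case: eqP vA => [->|]; rewrite ?(negbTE uA) ?mulr0.
  rewrite outc //; apply/imfsetP => -[v /= vA /(injf u v uU) E].
  by rewrite E vA in uA.
have uniqL A B c d x : A \in L -> B \in L -> bary A c x -> bary B d x -> c = d.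
  move=> /imfsetP[S /= SX ->] /imfsetP[S' /= SX' ->] bc bd.
  apply/funext => w.
  have [[u uU ->]|no] := pselect (exists2 u, u \in U & w = f u).
    by rewrite -(coordE _ _ _ _ uU SX bc) (coordE _ _ _ _ uU SX' bd).
  rewrite (bary_out bc) ?(bary_out bd) //; apply/imfsetP => -[v /= vS wE];
    by apply: no; exists v => //; apply: AU vS.
exists n, (complex_of_bary clL uniqL).
apply: (@simplicial_isomorphicI _ _ _ _ clX f).
- by move=> A B u v AX _ uA _; apply: injf; apply: AU uA.
- by move=> A AX; apply/imfsetP; exists A.
- by move=> B /imfsetP[A /= AX ->]; exists A.
Qed.

(** Quantified over all realizations, so that a composition may use any realization of the middle
    complex. *)
Definition abstract_equivalent (V W : choiceType) (X : {fset {fset V}})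
    (Y : {fset {fset W}}) : Prop :=
  forall N M (K : complex R N) (L : complex R M),
    simplicial_isomorphic X K -> simplicial_isomorphic Y L -> stellar_equivalent K L.

Lemma abstract_equivalent_trans (V W Z : choiceType) (X : {fset {fset V}})
    (Y : {fset {fset W}}) (Y' : {fset {fset Z}}) : face_closed Y ->
  abstract_equivalent X Y -> abstract_equivalent Y Y' -> abstract_equivalent X Y'.
Proof.
move=> clY XY YY' N M K L XK Y'L; have [N' [K' YK']] := realizable clY.
exact: stellar_equivalent_trans (XY _ _ _ _ XK YK') (YY' _ _ _ _ YK' Y'L).
Qed.

Lemma abstract_equivalent_iso (V W : choiceType) (v0 : V) (X : {fset {fset V}})
    (Y : {fset {fset W}}) : face_closed X -> face_closed Y ->
  simplicial_isomorphic X Y -> abstract_equivalent X Y.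
Proof.
move=> clX clY XY N M K L XK YL; apply/stellar_equivalent_move/move_isomorphism.
have clK := @complex_face_closed _ _ K.
have KX := simplicial_isomorphic_sym v0 clX clK XK.
exact: (simplicial_isomorphic_trans clK KX (simplicial_isomorphic_trans clX XY YL)).
Qed.

Lemma iso_subset (V W : choiceType) (f : V -> W) g X Y (A S : {fset V}) :
  iso_pair f g X Y -> A \in X -> S \in X -> f @` A `<=` f @` S -> A `<=` S.
Proof.
move=> [gK _ _ _] AX SX sub; apply/fsubsetP => v vA.
have /imfsetP[u /= uS E] := fsubsetP sub (f v) (in_imfset _ _ vA).
by rewrite -(gK A v) // E (gK S).
Qed.

(** The new vertex goes to the barycenter of the image of [A]. If [A] is a single vertex this is an
    old point, but then no simplex of the subdivision contains the old vertex any more. *)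
Lemma stellar_realization (V : choiceType) (X : {fset {fset V}}) (A : {fset V}) x N
    (K : complex R N) : face_closed X -> A \in X -> A != fset0 -> [fset x] \notin X ->
  simplicial_isomorphic X K ->
  exists2 K' : complex R N, stellar_subdivision K' K &
    simplicial_isomorphic (stellar A x X) K'.
Proof.
move=> clX AX A0 xX /(simplicial_isomorphicE clX (@complex_face_closed _ _ K) x)[f [g fg]].
have gf := iso_pair_sym fg; have [gK fK img img'] := fg.
have A'K := img A AX; set A' := f @` A in A'K.
have [alpha bA alpha0] : exists2 c, bary A' c (center A') & forall v, v \in A' -> 0 < c v.
  apply: bary_center; have /fset0Pn[v vA] := A0.
  by apply/fset0Pn; exists (f v); rewrite in_imfset.
set a := center A' in bA.
have fresh := stellar_fresh A'K bA alpha0.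
have freshX : [fset x] \in X -> A = [fset x] by rewrite (negbTE xX).
have clK := @complex_face_closed _ _ K.
have xS S : S \in X -> x \notin S.
  by move=> SX; apply: contra xX => xS; apply: clX SX _; rewrite fsub1set.
have clSt := stellar_face_closed clX freshX.
exists (stellar_complex A'K bA alpha0); first exact: stellar_complexP.
pose h v := if v == x then a else f v.
have hf S : x \notin S -> h @` S = f @` S.
  move=> nS; apply: eq_in_imfset => // v vS; rewrite /h.
  by case: eqP vS => // ->; rewrite (negbTE nS).
have afS S : S \in X -> ~~ (A `<=` S) -> a \notin f @` S.
  move=> SX; apply: contra => afS; apply: (iso_subset fg AX SX).
  rewrite -/A' fresh ?fsub1set //.
  by apply: simplexes_face (img S SX) _; rewrite fsub1set.
have SA_X S : S `|` A \in X -> S \in X by move=> /clX; apply; apply: fsubsetUl.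
apply: (@simplicial_isomorphicI _ _ _ _ clSt h).
- move=> S S' u v /(stellarP _ clX freshX) HS /(stellarP _ clX freshX) HS' uS vS'.
  have part Z w : w \in Z -> w != x -> [/\ x \notin Z, Z \in X & ~~ (A `<=` Z)] \/
      [/\ x \in Z, Z `\ x `|` A \in X & ~~ (A `<=` Z `\ x)] ->
      exists Y, [/\ Y \in X, w \in Y & ~~ (A `<=` Y)].
    move=> wZ wx [[_ ZX nA]|[_ ZA nA]]; first by exists Z.
    by exists (Z `\ x); rewrite !inE wx wZ; split=> //; apply: SA_X.
  rewrite /h; case: eqP => [->|/eqP ux]; case: eqP => [->|/eqP vx] // E.
  + have [Y [YX vY /(afS Y YX)/negP[]]] := part _ _ vS' vx HS'.
    by rewrite E in_imfset.
  + have [Y [YX uY /(afS Y YX)/negP[]]] := part _ _ uS ux HS.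
    by rewrite -E in_imfset.
  + have [Y [YX uY _]] := part _ _ uS ux HS.
    have [Y' [YX' vY' _]] := part _ _ vS' vx HS'.
    by rewrite -(gK Y u) // E (gK Y').
- move=> S /(stellarP _ clX freshX)[[nS SX nA]|[xIS SA nA]]; apply/(stellarP _ clK fresh).
    left; rewrite hf //; split; [exact: afS|exact: img|].
    by apply: contra nA; apply: iso_subset fg AX SX.
  have SX := SA_X _ SA; have nx := xS _ SX.
  have -> : h @` S = a |` f @` (S `\ x).
    by rewrite -[in LHS](fsetD1K xIS) imfsetU imfset_fset1 /h eqxx -/h hf.
  right; rewrite fset1U1 fsetU1K ?afS //; split=> //.
    by rewrite -imfsetU; apply: img.
  by apply: contra nA; apply: iso_subset fg AX SX.
- have gfA : g @` A' = A.
    rewrite -imfset_comp -[RHS]imfset_id; apply: eq_in_imfset => // v vA /=.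
    by rewrite (gK A).
  have fgB B : B \in simplexes K -> f @` (g @` B) = B.
    move=> BK; rewrite -imfset_comp -[RHS]imfset_id; apply: eq_in_imfset => // v vB /=.
    by rewrite (fK B).
  have sub' B : B \in simplexes K -> A `<=` g @` B -> A' `<=` B.
    by move=> BK; rewrite -{1}gfA; apply: iso_subset gf A'K BK.
  move=> B /(stellarP _ clK fresh)[[aB BK nA]|[aB BA nA]].
    have gBX := img' B BK.
    exists (g @` B); last by rewrite hf ?fgB // xS.
    apply/(stellarP _ clX freshX); left; split=> //; first exact: xS.
    by apply: contra nA; apply: sub'.
  have BK : B `\ a \in simplexes K by apply: clK BA _; apply: fsubsetUl.
  have gBX := img' _ BK; have nx := xS _ gBX.
  exists (x |` g @` (B `\ a)).
    apply/(stellarP _ clX freshX); right; rewrite fset1U1 fsetU1K //; split=> //.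
      by rewrite -gfA -imfsetU; apply: img'.
    by apply: contra nA; apply: sub'.
  by rewrite imfsetU imfset_fset1 /h eqxx -/h hf // fgB // fsetD1K.
Qed.

Lemma abstract_flip (V : choiceType) (X Y : {fset {fset V}}) (A B : {fset V}) x :
  face_closed X -> face_closed Y -> A \in X -> B \in Y -> A != fset0 -> B != fset0 ->
  [fset x] \notin X -> [fset x] \notin Y -> stellar A x X = stellar B x Y ->
  abstract_equivalent X Y.
Proof.
move=> clX clY AX BY A0 B0 xX xY E N M K L XK YL.
have [K' KK' isoK'] := stellar_realization clX AX A0 xX XK.
have [L' LL' isoL'] := stellar_realization clY BY B0 xY YL.
have freshX : [fset x] \in X -> A = [fset x] by rewrite (negbTE xX).
apply: stellar_step (move_subdivision KK') _.
apply: stellar_equivalent_trans (stellar_equivalent_move (move_weld LL')).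
apply/stellar_equivalent_move/move_isomorphism.
have clK' := @complex_face_closed _ _ K'.
have KX := simplicial_isomorphic_sym x (stellar_face_closed clX freshX) clK' isoK'.
by rewrite E in KX; apply: (simplicial_isomorphic_trans clK' KX isoL').
Qed.

End Realization.

(** * From a regular subdivision to the derived subdivision *)

Section Derived.
Variables (R : realType) (N : nat) (K T : complex R N).
Local Notation P := 'rV[R]_N.
Hypothesis TK : subdivision T K.
Hypothesis K0 : fset0 \in simplexes K.
Implicit Types (S s r t F A B : {fset P}) (D : {fset {fset P}}) (C : {fset P} -> bool).

Definition mixed : choiceType := (P + {fset P})%type.
Implicit Types (Z : {fset mixed}).

(* A simplex of mixed vertices consists of vertices of T and of barycenters of
   simplexes of K. *)
Definition points Z : {fset P} :=
  [fset (if z is inl v then v else 0) | z in Z & (if z is inl _ then true else false)].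
Definition cells Z : {fset P} -> bool := fun t => (inr t : mixed) \in Z.

Lemma in_points Z v : (v \in points Z) = ((inl v : mixed) \in Z).
Proof.
apply/imfsetP/idP => [[[u|t] /=]|vZ]; last by exists (inl v); rewrite ?inE /= ?vZ.
  by rewrite !inE /= andbT => uZ ->.
by rewrite !inE andbF.
Qed.

Definition inpoints S : {fset mixed} := [fset (inl v : mixed) | v in S].

Lemma in_inpoints_inl S v : ((inl v : mixed) \in inpoints S) = (v \in S).
Proof.
apply/imfsetP/idP => [[u /= uS [->]]//|vS]; by exists v.
Qed.

Lemma in_inpoints_inr S t : ((inr t : mixed) \in inpoints S) = false.
Proof. by apply/imfsetP => -[]. Qed.

(** A finite stock of vertices, which lets [family] turn a predicate into a finite set of
    simplexes. *)
Definition universe : {fset mixed} :=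
  inpoints (\bigcup_(S <- simplexes T) S) `|` [fset (inr t : mixed) | t in simplexes K].

Definition family (Q : {fset P} -> ({fset P} -> bool) -> Prop) : {fset {fset mixed}} :=
  [fset Z in fpowerset universe | `[< Q (points Z) (cells Z) >]].

Definition is_chain C : Prop := forall t u, C t -> C u -> (t `<=` u) || (u `<=` t).

Definition wf D S C : Prop :=
  [/\ S \in simplexes T, is_chain C & forall t, C t -> t \in D].

Definition below D S C : Prop :=
  exists r, [/\ r \in simplexes K, r \notin D, inside S r & forall t, C t -> r `<` t].

(** [T] with the simplexes of [D] coned off from their barycenters: for empty [D] this is [T], and
    for all nonempty simplexes of [K] the derived subdivision. *)
Definition derived D S C : Prop := wf D S C /\ below D S C.

Definition covered (Fs : seq {fset P}) S : Prop := exists2 F, F \in Fs & S `<=` F.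

(* The intermediate stage in which the facets pre of s are already coned off
   from the barycenter of s. *)
Definition partial D s pre post S C : Prop :=
  wf (s |` D) S C /\
  (if C s then covered pre S /\ (covered post S \/ on_boundary K s S)
   else below (s |` D) S C \/ covered post S /\ (forall t, C t -> s `<` t)).

Lemma familyP Q D Z : D `<=` simplexes K -> (forall S C, Q S C -> wf D S C) ->
  Z \in family Q <-> Q (points Z) (cells Z).
Proof.
move=> DK Qwf; rewrite !inE; split=> [/andP[_ /asboolP]//|QZ].
apply/andP; split; last exact/asboolP.
have [ZT _ ZD] := Qwf _ _ QZ.
rewrite fpowersetE; apply/fsubsetP => -[v|t] zZ; rewrite inE; apply/orP.
  left; rewrite in_inpoints_inl; apply/bigfcupP; exists (points Z); rewrite ?ZT //.
  by rewrite in_points.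
by right; apply/imfsetP; exists t => //=; apply/(fsubsetP DK)/ZD.
Qed.

Lemma covered_sub Fs S S' : S' `<=` S -> covered Fs S -> covered Fs S'.
Proof. by move=> sub [F FFs SF]; exists F => //; apply: fsubset_trans sub SF. Qed.

Lemma inside_sub S S' r : S' `<=` S -> inside S r -> inside S' r.
Proof. by move=> sub H v /(fsubsetP sub)/H. Qed.

Lemma on_boundary_sub s S S' : S' `<=` S -> on_boundary K s S -> on_boundary K s S'.
Proof. by move=> sub [r [rK rs Sr]]; exists r; split=> //; apply: inside_sub Sr. Qed.

Lemma wf_sub D S S' C C' : S' `<=` S -> (forall t, C' t -> C t) -> wf D S C -> wf D S' C'.
Proof.
move=> sub CC [ST ch CD]; split; first exact: simplexes_face ST sub.
  by move=> t u /CC Ct /CC Cu; apply: ch.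
by move=> t /CC/CD.
Qed.

Lemma below_sub D S S' C C' : S' `<=` S -> (forall t, C' t -> C t) ->
  below D S C -> below D S' C'.
Proof.
move=> sub CC [r [rK rD Sr Cr]]; exists r; split=> //; first exact: inside_sub Sr.
by move=> t /CC/Cr.
Qed.

Lemma points_sub Z Z' : Z' `<=` Z -> points Z' `<=` points Z.
Proof. by move=> /fsubsetP sub; apply/fsubsetP => v; rewrite !in_points => /sub. Qed.

Lemma cells_sub Z Z' t : Z' `<=` Z -> cells Z' t -> cells Z t.
Proof. by move=> /fsubsetP sub; apply: sub. Qed.

Lemma family_face_closed Q D : D `<=` simplexes K -> (forall S C, Q S C -> wf D S C) ->
  (forall S S' C C', S' `<=` S -> (forall t, C' t -> C t) -> Q S C -> Q S' C') ->
  face_closed (family Q).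
Proof.
move=> DK Qwf mono Z Z' /(familyP _ DK Qwf) QZ sub; apply/(familyP _ DK Qwf).
by apply: mono QZ; [apply: points_sub|move=> t; apply: cells_sub].
Qed.

Lemma derived_wf D S C : derived D S C -> wf D S C.
Proof. by case. Qed.

Lemma derived_sub D S S' C C' : S' `<=` S -> (forall t, C' t -> C t) ->
  derived D S C -> derived D S' C'.
Proof. by move=> sub CC [w b]; split; [apply: wf_sub w|apply: below_sub b]. Qed.

(** * Coning off one simplex whose proper cofaces are done *)

Section Step.
Variables (D : {fset {fset P}}) (s : {fset P}) (Fs : seq {fset P}).
Hypothesis DK : D `<=` simplexes K.
Hypothesis D0 : fset0 \notin D.
Hypothesis Dup : forall t u, t \in D -> u \in simplexes K -> t `<=` u -> u \in D.
Hypotheses (sK : s \in simplexes K) (sD : s \notin D) (s0 : s != fset0).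
Hypothesis smax : forall t, t \in simplexes K -> s `<` t -> t \in D.
Hypothesis shFs : shelling K T s Fs.

Let D' := s |` D.

Let D'K : D' `<=` simplexes K.
Proof. by rewrite fsubUset fsub1set sK. Qed.

Lemma above_s C t : is_chain C -> (forall u, C u -> u \in D') -> C s -> C t -> t != s ->
  s `<` t.
Proof.
move=> ch CD Cs Ct ts; have := CD t Ct; rewrite !inE (negbTE ts) /= => tD.
rewrite fproperEneq eq_sym ts /=; have /orP[//|tS] := ch s t Cs Ct.
by case/negP: sD; apply: Dup tD sK tS.
Qed.

Lemma partial_wf pre post S C : partial D s pre post S C -> wf D' S C.
Proof. by case. Qed.

Lemma boundary_below S C : on_boundary K s S -> (forall t, C t -> s `<=` t) -> below D' S C.
Proof.
move=> [r [rK rs Sr]] Cs; exists r; split=> //.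
  rewrite !inE negb_or (fproper_neq rs) /=; apply: contra sD => rD.
  exact: Dup rD sK (fproper_sub rs).
by move=> t /Cs; apply: fproper_sub_trans.
Qed.

(** The delicate case is a set of cells that loses [s]. The base of the cone is the frontier of the
    coned part, so its faces remain present, either in a later facet or in a proper face of [s] that
    is still untouched. *)
Lemma partial_sub pre post S S' C C' : S' `<=` S -> (forall t, C' t -> C t) ->
  partial D s pre post S C -> partial D s pre post S' C'.
Proof.
move=> sub CC [w H]; split; first exact: wf_sub w.
have [_ ch CD] := w.
case: ifPn => [Cs'|nCs'].
  rewrite (CC s Cs') in H; case: H => cpre cpost; split; first exact: covered_sub cpre.
  by case: cpost => [/(covered_sub sub)|/(on_boundary_sub sub)]; [left|right].
case: ifP H => [Cs [_ cpost]|_ [b|[cpost Ct]]].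
- have above t : C' t -> s `<` t.
    move=> Ct'; apply: (above_s ch CD Cs (CC t Ct')).
    by apply: contraNneq nCs' => <-.
  case: cpost => [/(covered_sub sub) c|/(on_boundary_sub sub) b]; first by right.
  by left; apply: boundary_below b _ => t /above/fproper_sub.
- by left; apply: below_sub b.
- by right; split; [apply: covered_sub cpost|move=> t /CC/Ct].
Qed.

Let partP pre post Z : Z \in family (partial D s pre post) <->
  partial D s pre post (points Z) (cells Z).
Proof. exact: familyP D'K (@partial_wf pre post). Qed.

Lemma partial_face_closed pre post : face_closed (family (partial D s pre post)).
Proof. exact: family_face_closed D'K (@partial_wf _ _) (@partial_sub _ _). Qed.

(** When [s] itself serves as [r] in [below], it is replaced by a facet of the shelling that
    contains [S]. *)
Lemma partial_start : family (derived D) = family (partial D s [::] Fs).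
Proof.
have [FsP cov _] := shFs.
apply/fsetP => Z; apply/idP/idP.
  move/(familyP _ DK (@derived_wf D)) => [[ZT ch CD] [r [rK rD Zr Cr]]]; apply/partP.
  split; first by split=> // t /CD tD; rewrite !inE tD orbT.
  case: ifP => [/CD|_]; first by rewrite (negbTE sD).
  have [rs|rs] := eqVneq r s; last by left; exists r; rewrite !inE negb_or rs.
  by right; split; [apply: cov ZT _; rewrite -rs|rewrite -rs].
move/partP => [[ZT ch CD] H]; apply/(familyP _ DK (@derived_wf D)).
move: H; case: ifPn => [_ [[F]]//|nCs H].
split.
  split=> // t Ct; have := CD t Ct; rewrite !inE => /orP[/eqP ts|//].
  by rewrite -ts Ct in nCs.
case: H => [[r [rK rD Zr Cr]]|[[F /FsP[FT Fs'] ZF] Ct]].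
  by exists r; split=> //; apply: contra rD => rD; rewrite inE rD orbT.
by exists s; split=> //; apply: inside_sub Fs'.
Qed.

Lemma partial_end : family (partial D s Fs [::]) = family (derived D').
Proof.
have [FsP cov _] := shFs.
apply/fsetP => Z; apply/idP/idP.
  move/partP => [w H]; apply/(familyP _ D'K (@derived_wf D')).
  split=> //; have [ZT ch CD] := w.
  move: H; case: ifPn => [Cs [_ [[F]//|b]]|_ [//|[[F]//]]].
  apply: boundary_below b _ => t Ct; have [->|ts] := eqVneq t s; first exact: fsubset_refl.
  exact/fproper_sub/(above_s ch CD Cs Ct ts).
move/(familyP _ D'K (@derived_wf D')) => [w b]; apply/partP; split=> //.
have [ZT ch CD] := w.
case: ifPn => [Cs|_]; last by left.
case: b => r [rK rD Zr Cr]; split; last by right; exists r; split=> //; apply: Cr.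
apply: cov ZT _ => v /Zr; apply: hull_sub; exact/fproper_sub/Cr.
Qed.

Section Flip.
Variables (pre post : seq {fset P}) (F A B : {fset P}).
Hypothesis FT : F \in simplexes T.
Hypothesis AB : A `|` B = F.
Hypothesis dAB : fdisjoint A B.
Hypothesis preF : forall G, G `<=` F -> covered pre G <-> ~~ (B `<=` G).
Hypothesis postF : forall G, G `<=` F ->
  covered post G \/ on_boundary K s G <-> ~~ (A `<=` G).

Let AF : A `<=` F. Proof. by rewrite -AB fsubsetUl. Qed.
Let BF : B `<=` F. Proof. by rewrite -AB fsubsetUr. Qed.

Let nAS S : A `<=` S -> covered post S \/ on_boundary K s S -> False.
Proof.
move=> AS H; have /postF-/(_ AF) : covered post A \/ on_boundary K s A.
  by case: H => [/(covered_sub AS)|/(on_boundary_sub AS)]; [left|right].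
by rewrite fsubset_refl.
Qed.

Let nBS S : B `<=` S -> covered pre S -> False.
Proof. by move=> BS /(covered_sub BS)/(preF BF); rewrite fsubset_refl. Qed.

Let covered_cons S : covered (F :: post) S <-> S `<=` F \/ covered post S.
Proof.
split=> [[G]|[SF|[G Gp SG]]].
- by rewrite inE => /predU1P[->|Gp]; [left|right; exists G].
- by exists F; rewrite ?mem_head.
- by exists G; rewrite // inE Gp orbT.
Qed.

Let covered_rcons S : covered (rcons pre F) S <-> S `<=` F \/ covered pre S.
Proof.
split=> [[G]|[SF|[G Gp SG]]].
- by rewrite mem_rcons inE => /predU1P[->|Gp]; [left|right; exists G].
- by exists F; rewrite // mem_rcons mem_head.
- by exists G; rewrite // mem_rcons inE Gp orbT.
Qed.

(* By maximality of s, a simplex of T inside s and inside some r outside D'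
   lies on the boundary of s. *)
Let below_boundary S C : inside S s -> below D' S C -> on_boundary K s S.
Proof.
move=> Ss [r [rK rD Sr _]]; exists (s `&` r); split.
- exact: simplexes_face sK (fsubsetIl _ _).
- rewrite fproperE fsubsetIl /= fsubsetI fsubset_refl /=; apply: contra rD => sr.
  rewrite !inE; have [//|rs /=] := eqVneq r s.
  by apply: smax => //; rewrite fproperEneq eq_sym rs.
- by move=> v vS; apply: (hullI sK rK); [apply: Ss|apply: Sr].
Qed.

Hypothesis Fs' : inside F s.

Let below_A S C : A `<=` S -> below D' S C -> False.
Proof.
move=> AS /(below_sub AS (fun t H => H)) b; apply: (@nAS A (fsubset_refl _)); right.
exact: below_boundary (inside_sub AF Fs') b.
Qed.

Lemma flip_outside S C :
  partial D s pre (F :: post) S C /\ ~~ (A `<=` S) <->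
  partial D s (rcons pre F) post S C /\ ~~ (C s && (B `<=` S)).
Proof.
split=> -[[w H] nA].
  split; [split=> //|]; move: H; case: ifPn => Cs /=.
  - move=> [cpre cpost]; split; first by apply/covered_rcons; right.
    case: cpost => [/covered_cons[SF|]|]; [exact/postF|by left|by right].
  - case=> [b|[/covered_cons[SF|c] Ct]]; [by left| |by right].
    have [c|b] := (postF SF).2 nA; first by right.
    by left; apply: boundary_below b _ => t /Ct/fproper_sub.
  - by move=> [cpre _]; apply/negP => /nBS; apply.
  - by [].
split; [split=> //|]; move: H nA; case: ifPn => Cs /=.
- move=> [cpre cpost] nB; split; last first.
    by case: cpost => [c|b]; [left; apply/covered_cons; right|right].
  by case/covered_rcons: cpre => [SF|//]; apply/preF.
- by case=> [b|[c Ct]] _; [left|right; split=> //; apply/covered_cons; right].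
- by move=> [_ cpost] _; apply/negP => /nAS; apply.
- by case=> [b|[c _]] _; apply/negP => AS; [apply: below_A AS b|apply: (nAS AS); left].
Qed.

(** Matches the simplexes that contain the new vertex: [A] is traded for [B] together with the
    barycenter of [s]. *)
Lemma flip_inside S C :
  partial D s pre (F :: post) (S `|` A) C /\ ~~ (A `<=` S) <->
  partial D s (rcons pre F) post (S `|` B) (fun t => C t || (t == s)) /\
    ~~ (C s && (B `<=` S)).
Proof.
have FSA : S `|` A `<=` F <-> S `|` B `<=` F.
  by rewrite !fsubUset AF BF !andbT.
have nASB : ~~ (A `<=` S `|` B) = ~~ (A `<=` S).
  congr (~~ _); apply/idP/idP => sub.
    apply/fsubsetP => v vA; have := fsubsetP sub v vA; rewrite inE => /orP[//|vB].
    by move/fdisjointP: dAB => /(_ v vA); rewrite vB.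
  exact: fsubset_trans sub (fsubsetUl _ _).
have nBSA : ~~ (B `<=` S `|` A) = ~~ (B `<=` S).
  congr (~~ _); apply/idP/idP => sub.
    apply/fsubsetP => v vB; have := fsubsetP sub v vB; rewrite inE => /orP[//|vA].
    by move/fdisjointP: dAB => /(_ v vA); rewrite vB.
  exact: fsubset_trans sub (fsubsetUl _ _).
have ASA : A `<=` S `|` A by apply: fsubsetUr.
have BSB : B `<=` S `|` B by apply: fsubsetUr.
split=> -[[[ST ch CD] H] nA].
  (* The star of [A] lies over [F] alone: elsewhere [A] would be in a later facet or on the boundary
     of [s], against [postF]. The cells other than [s] are then strictly above [s]. *)
  have [SF Ct] : S `|` A `<=` F /\ (forall t, C t -> t != s -> s `<` t).
    move: H; case: ifPn => Cs.
      move=> [_ H]; split.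
        by case: H => [/covered_cons[//|c]|b]; case: (nAS ASA); [left|right].
      by move=> t; apply: above_s ch CD Cs.
    case=> [/(below_A ASA)//|[/covered_cons[SF|c] Ct]].
      by split=> // t /Ct.
    by case: (nAS ASA); left.
  have SBF := FSA.1 SF; split; [split|].
  - split; first exact: simplexes_face FT SBF.
      move=> t u /orP[Ct'|/eqP ->] /orP[Cu|/eqP ->]; rewrite ?fsubset_refl //.
      + exact: ch.
      + by have [->|/(Ct t Ct')/fproper_sub ->] := eqVneq t s; rewrite ?fsubset_refl ?orbT.
      + by have [->|/(Ct u Cu)/fproper_sub ->] := eqVneq u s; rewrite ?fsubset_refl ?orbT.
    by move=> t /orP[/CD//|/eqP ->]; rewrite !inE eqxx.
  - rewrite eqxx orbT; split; first by apply/covered_rcons; left.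
    by apply/postF => //; rewrite nASB.
  - apply/negP => /andP[Cs BS]; rewrite Cs in H; case: H => cpre _.
    by apply: nBS cpre; apply: fsubset_trans BS (fsubsetUl _ _).
rewrite eqxx orbT in H; case: H => cpre cpost.
have SBF : S `|` B `<=` F by case/covered_rcons: cpre => // /(nBS BSB).
have SF := FSA.2 SBF; have nAS' : ~~ (A `<=` S) by rewrite -nASB; apply/postF.
have ch' : is_chain C by move=> t u Ct Cu; apply: ch; rewrite ?Ct ?Cu.
have CD' t : C t -> t \in D' by move=> Ct; apply: CD; rewrite Ct.
split=> //; split; first by split=> //; apply: simplexes_face FT SF.
case: ifPn => Cs.
  rewrite Cs /= in nA; split; last by left; apply/covered_cons; left.
  by apply/preF => //; rewrite nBSA.
right; split; first by apply/covered_cons; left.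
move=> t Ct; apply: (above_s ch CD); rewrite ?Ct ?eqxx ?orbT //.
by apply: contraNneq Cs => <-.
Qed.

Lemma partial_flip : abstract_equivalent R
  (family (partial D s pre (F :: post))) (family (partial D s (rcons pre F) post)).
Proof.
(* [inr fset0] is a free name for the new vertex, since all cells come from [D'], which does not
   contain [fset0]. *)
pose x : mixed := inr fset0; pose A' := inpoints A; pose B' := (inr s : mixed) |` inpoints B.
have fK pre' post' := @partial_face_closed pre' post'.
have xP pre' post' : [fset x] \notin family (partial D s pre' post').
  apply/negP => /partP[[_ _ CD] _]; have := CD fset0.
  by rewrite /cells !inE eqxx (negbTE D0) orbF eq_sym (negbTE s0) => /(_ isT).
have pA Z : points (Z `|` A') = points Z `|` A.
  by apply/fsetP => v; rewrite in_fsetU !in_points in_fsetU in_inpoints_inl.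
have pB Z : points (Z `|` B') = points Z `|` B.
  apply/fsetP => v; rewrite in_fsetU !in_points in_fsetU in_fset1U in_inpoints_inl.
  by [].
have cA Z : cells (Z `|` A') = cells Z.
  by apply/funext => t; rewrite /cells in_fsetU in_inpoints_inr orbF.
have cB Z : cells (Z `|` B') = (fun t => cells Z t || (t == s)).
  by apply/funext => t; rewrite /cells in_fsetU in_fset1U in_inpoints_inr orbF.
have sI S Z : (inpoints S `<=` Z) = (S `<=` points Z).
  apply/fsubsetP/fsubsetP => sub => [v vS|[v|t]].
  - by rewrite in_points; apply: sub; rewrite in_inpoints_inl.
  - by rewrite in_inpoints_inl => /sub; rewrite in_points.
  - by rewrite in_inpoints_inr.
have sB Z : (B' `<=` Z) = cells Z s && (B `<=` points Z).
  by rewrite /B' fsubUset fsub1set sI.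
have AX : A' \in family (partial D s pre (F :: post)).
  have cA0 t : cells A' t = false by rewrite /cells in_inpoints_inr.
  have pA0 : points A' = A by apply/fsetP => v; rewrite in_points in_inpoints_inl.
  apply/partP; rewrite pA0; split; last first.
    rewrite cA0; right; split; first by apply/covered_cons; left.
    by move=> t; rewrite cA0.
  split; first exact: simplexes_face FT AF.
    by move=> t u; rewrite cA0.
  by move=> t; rewrite cA0.
(* The empty simplex is on the boundary of [s], so [A] is nonempty. [B] is empty for the first
   facet, where the flip amounts to starring [F]; the barycenter of [s] keeps [B'] nonempty. *)
have A0 : A != fset0.
  have /(postF (fsub0set F)) : covered post fset0 \/ on_boundary K s fset0.
    by right; exists fset0; rewrite fproper0; split.
  by rewrite fsubset0.
have BY : B' \in family (partial D s (rcons pre F) post).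
  have cB0 t : cells B' t = (t == s).
    by rewrite /cells in_fset1U in_inpoints_inr orbF.
  have pB0 : points B' = B.
    by apply/fsetP => v; rewrite in_points in_fset1U in_inpoints_inl.
  apply/partP; rewrite pB0; split; last first.
    rewrite cB0 eqxx; split; first by apply/covered_rcons; left.
    apply/postF => //; apply: contra A0 => sub.
    rewrite -fsubset0; apply/fsubsetP => v vA.
    by move/fdisjointP: dAB => /(_ v vA); rewrite (fsubsetP sub).
  split; first exact: simplexes_face FT BF.
    by move=> t u; rewrite !cB0 => /eqP -> /eqP ->; rewrite fsubset_refl.
  by move=> t; rewrite cB0 => /eqP ->; rewrite !inE eqxx.
have nzA : A' != fset0.
  have /fset0Pn[v vA] := A0; apply/fset0Pn; exists (inl v).
  by rewrite in_inpoints_inl.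
have nzB : B' != fset0 by apply/fset0Pn; exists (inr s); rewrite fset1U1.
apply: (abstract_flip (fK _ _) (fK _ _) AX BY nzA nzB (xP _ _) (xP _ _)).
have frX pre' post' E : [fset x] \in family (partial D s pre' post') -> E = [fset x].
  by rewrite (negbTE (xP _ _)).
apply/fsetP => Z; apply/idP/idP.
- move=> /(stellarP _ (fK _ _) (@frX _ _ _))[[nx /partP ZX nA]|[xZ /partP ZX nA]];
    apply/(stellarP _ (fK _ _) (@frX _ _ _)).
    rewrite sI in nA; have [ZY nB] := (flip_outside _ _).1 (conj ZX nA).
    by left; split=> //; [apply/partP|rewrite sB].
  rewrite sI in nA; rewrite pA cA in ZX.
  have [ZY nB] := (flip_inside _ _).1 (conj ZX nA).
  by right; split=> //; [apply/partP; rewrite pB cB|rewrite sB].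
- move=> /(stellarP _ (fK _ _) (@frX _ _ _))[[nx /partP ZY nB]|[xZ /partP ZY nB]];
    apply/(stellarP _ (fK _ _) (@frX _ _ _)).
    rewrite sB in nB; have [ZX nA] := (flip_outside _ _).2 (conj ZY nB).
    by left; split=> //; [apply/partP|rewrite sI].
  rewrite sB in nB; rewrite pB cB in ZY.
  have [ZX nA] := (flip_inside _ _).2 (conj ZY nB).
  by right; split=> //; [apply/partP; rewrite pA cA|rewrite sI].
Qed.

End Flip.

Lemma partial_sweep pre post : Fs = pre ++ post ->
  abstract_equivalent R (family (partial D s pre post)) (family (partial D s Fs [::])).
Proof.
elim: post pre => [|F post IH] pre EFs.
  rewrite EFs cats0.
  by apply: (abstract_equivalent_iso (inr fset0 : mixed));
    [apply: partial_face_closed..|apply/simplicial_isomorphic_refl/partial_face_closed].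
have [FsP _ /(_ _ _ _ EFs)[A [B [AB dAB preF postF]]]] := shFs.
have [FT Fs'] : F \in simplexes T /\ inside F s by apply: FsP; rewrite EFs mem_cat mem_head orbT.
apply: abstract_equivalent_trans (partial_flip FT AB dAB preF postF Fs') _.
  exact: partial_face_closed.
by apply: IH; rewrite cat_rcons.
Qed.

Lemma derived_step : abstract_equivalent R (family (derived D)) (family (derived D')).
Proof. by rewrite partial_start -partial_end; apply: partial_sweep. Qed.

End Step.

Lemma derived_face_closed D : D `<=` simplexes K -> face_closed (family (derived D)).
Proof. move=> DK; exact: family_face_closed DK (@derived_wf D) (@derived_sub D). Qed.

Lemma fset_max_card (E : {fset {fset P}}) : E != fset0 ->
  exists2 s, s \in E & forall t, t \in E -> (#|` t| <= #|` s|)%N.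
Proof.
case/fset0Pn=> t tE.
case: (@arg_maxnP _ [` tE]%fset xpredT (fun u : E => #|` val u|) isT) => s _ smax.
by exists (val s) => [|u uE]; [apply: valP|apply: (smax [` uE]%fset)].
Qed.

(** A simplex of largest cardinality outside [D] has all its proper cofaces in [D], so that adding
    it keeps [D] closed upwards. *)
Lemma derived_sweep f D : regular T K f -> D `<=` simplexes K -> fset0 \notin D ->
  (forall t u, t \in D -> u \in simplexes K -> t `<=` u -> u \in D) ->
  abstract_equivalent R (family (derived D)) (family (derived (simplexes K `\ fset0))).
Proof.
move=> regf; have [n] := ubnP #|` (simplexes K `\ fset0) `\` D|.
elim: n D => // n IH D; rewrite ltnS => le DK D0 Dup.
have [E0|/fset_max_card[s]] := eqVneq ((simplexes K `\ fset0) `\` D) fset0.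
  have -> : D = simplexes K `\ fset0.
    apply/eqP; rewrite eqEfsubset andbC -{1}fsetD_eq0 E0 eqxx.
    by apply/fsubsetP => t tD; rewrite in_fsetD1 (fsubsetP DK) // andbT;
      apply: contraNneq D0 => <-.
  apply: (abstract_equivalent_iso (inr fset0 : mixed));
    try apply/simplicial_isomorphic_refl; exact/derived_face_closed/fsubsetDl.
rewrite !inE => /and3P[sD s0 sK] smax'.
have smax t : t \in simplexes K -> s `<` t -> t \in D.
  move=> tK st; apply: contraTT (fproper_ltn_card st) => tD; rewrite -leqNgt.
  apply: smax'; rewrite !inE tD tK andbT /=.
  by apply: contraTneq st => ->; rewrite fproperE fsubset0 (negbTE s0).
have [Fs shFs] := regular_shelling TK regf sK s0.
have D'K : s |` D `<=` simplexes K by rewrite fsubUset fsub1set sK.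
apply: abstract_equivalent_trans (derived_step DK D0 Dup sK sD s0 smax shFs) _.
  exact: derived_face_closed.
apply: IH => //.
- apply: leq_trans le; apply: fproper_ltn_card.
  rewrite fproperE fsetDS ?fsubsetUr //=; apply/fsubsetPn; exists s.
    by rewrite !inE sD s0.
  by rewrite !inE eqxx.
- by rewrite !inE negb_or D0 andbT eq_sym.
- move=> t u; rewrite !inE => /predU1P[->|tD] uK tu; last by rewrite (Dup t) ?orbT.
  by have [//|us /=] := eqVneq u s; apply: smax => //; rewrite fproperEneq eq_sym us.
Qed.

Lemma derived0 : simplicial_isomorphic (simplexes T) (family (derived fset0)).
Proof.
have sub0 : fset0 `<=` simplexes K by apply: fsub0set.
have dP := familyP _ sub0 (@derived_wf fset0).
apply: (@simplicial_isomorphicI _ _ _ _ (@complex_face_closed _ _ T) inl).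
- by move=> A B u v _ _ _ _ [].
- move=> S ST; apply/dP.
  have cS t : cells (inpoints S) t = false by rewrite /cells in_inpoints_inr.
  have -> : points [fset inl x | x in S] = S.
    by apply/fsetP => v; rewrite in_points in_inpoints_inl.
  split; first by split=> // [t u|t]; rewrite cS.
  have [r rK Sr] := ((subdivisionP _ _).1 TK).1 S ST.
  by exists r; split=> // t; rewrite cS.
- move=> Z /dP[[ZT _ C0] _]; exists (points Z) => //.
  apply/fsetP => -[v|t]; first by rewrite in_inpoints_inl in_points.
  by rewrite in_inpoints_inr; apply/negP => /C0.
Qed.

Hypothesis T0 : fset0 \in simplexes T.

(** Only the empty simplex is left to carry vertices of [T], so none remain. The description
    mentions [K] alone, which is why all regular subdivisions of [K] end at the same complex. *)
Lemma derived_fullP Z : Z \in family (derived (simplexes K `\ fset0)) <->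
  [/\ points Z = fset0, is_chain (cells Z) &
    forall t, cells Z t -> t \in simplexes K `\ fset0].
Proof.
have dP := familyP Z (fsubsetDl _ _) (@derived_wf (simplexes K `\ fset0)).
split=> [/dP[[_ ch CD] [r [rK rD Zr _]]]|[pZ ch CD]].
  split=> //; apply/fsetP => v; rewrite inE; apply/negP => /Zr.
  suff -> : r = fset0 by apply: hull_fset0.
  by move: rD; rewrite in_fsetD1 rK andbT negbK => /eqP.
apply/dP; split; first by split; rewrite ?pZ.
exists fset0; split; rewrite ?in_fsetD1 ?eqxx ?pZ //.
by move=> t /CD; rewrite in_fsetD1 fproper0 => /andP[].
Qed.

End Derived.

(** * Every subdivision is stellar equivalent to its complex *)

Section Main.
Variable R : realType.

Lemma regular_equivalent N (K T : complex R N) f : subdivision T K ->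
  fset0 \in simplexes K -> fset0 \in simplexes T -> regular T K f ->
  stellar_equivalent T K.
Proof.
move=> TK K0 T0 regf.
have sweep (S : complex R N) g : subdivision S K -> regular S K g ->
    abstract_equivalent R (simplexes S) (family K S (derived K S (simplexes K `\ fset0))).
  move=> SK regg.
  have cl0 : face_closed (family K S (derived K S fset0)).
    exact/derived_face_closed/fsub0set.
  apply: (abstract_equivalent_trans cl0).
    apply: (abstract_equivalent_iso (0 : 'rV[R]_N) (@complex_face_closed _ _ S) cl0).
    exact: derived0.
  by apply: (derived_sweep SK K0 regg); rewrite ?fsub0set.
have E : family K T (derived K T (simplexes K `\ fset0)) =
         family K K (derived K K (simplexes K `\ fset0)).
  have TP := derived_fullP K0 T0; have KP := derived_fullP K0 K0.
  by apply/fsetP => Z; apply/idP/idP => [/TP/KP|/KP/TP].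
have clF : face_closed (family K T (derived K T (simplexes K `\ fset0))).
  exact/derived_face_closed/fsubsetDl.
have [M [L isoL]] := realizable R clF.
have iso (S : complex R N) : simplicial_isomorphic (simplexes S) (simplexes S).
  exact/simplicial_isomorphic_refl/complex_face_closed.
apply: stellar_equivalent_trans (sweep T f TK regf _ _ T L (iso T) isoL) _.
apply: stellar_equivalent_sym; rewrite E in isoL.
exact: (sweep K _ (subdivision_refl K) (@regular_refl _ _ K) _ _ K L (iso K) isoL).
Qed.

(** The empty collection subdivides the complex whose only simplex is [fset0]; a nonempty simplex of
    [K] rules this out. *)
Lemma subdivision_nonempty N (K T : complex R N) A : subdivision T K ->
  A \in simplexes K -> A != fset0 -> fset0 \in simplexes T.
Proof.
move=> /subdivisionP[_ H] AK /fset0Pn[v vA].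
have [S ST _] := H A v AK (hull_vertex vA).
exact: simplexes_face ST (fsub0set _).
Qed.

Lemma subdivision_equivalent N (K K' : complex R N) A : subdivision K' K ->
  A \in simplexes K -> A != fset0 -> stellar_equivalent K K'.
Proof.
move=> K'K AK A0; have K'0 := subdivision_nonempty K'K AK A0.
have K0 : fset0 \in simplexes K := simplexes_face AK (fsub0set _).
have [hs hsP] := complex_halfspaces K'.
(* [K'] is cut along its own walls, so that none of them crosses a simplex of [T], as
   [regular_coarsen] requires. *)
have [T [K'T TK' hsT]] := common_cut hsP (erefl (polyhedron K')) K'0.
have [g regg] := regular_chain K'T.
have [f regf] := regular_coarsen K'K TK' K'0 hsP hsT regg.
have TK := subdivision_trans TK' K'K.
have T0 := subdivision_nonempty TK AK A0.
apply: stellar_equivalent_trans (stellar_equivalent_sym (regular_equivalent TK K0 T0 regf)) _.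
exact/stellar_equivalent_sym/stellar_chain_equivalent.
Qed.

End Main.

Theorem theorem4p5 (R : realType) (n N M : nat)
    (K : complex R N) (L : complex R M)
    (dimK : has_dim K n) (dimL : has_dim L n) :
  pl_homeomorphic K L <-> stellar_equivalent K L.
Proof.
have [[A AK cA] _] := dimK; have [[B BL cB] _] := dimL.
have A0 : A != fset0 by rewrite -cardfs_gt0 cA.
have B0 : B != fset0 by rewrite -cardfs_gt0 cB.
split=> [[K' [L' [K'K L'L iso]]]|KL]; last first.
  exact: pl_of_stellar KL (simplexes_face AK (fsub0set _)).
apply: stellar_equivalent_trans (subdivision_equivalent K'K AK A0) _.
apply: stellar_step (move_isomorphism iso) _.
exact/stellar_equivalent_sym/(subdivision_equivalent L'L BL B0).
Qed.
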